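(* Let $P(z)$ be a polynomial over $\mathbb{K}$ having only simple zeros, and let $t$ and $t'$ be the numbers attached to $P$ as defined in the context. If $t\ge 3$ and $t'\ge 3$, then $P(z)$ is a UPM in $\mathbb{K}$.
   Context: $\mathbb{K}$ is an algebraically closed field of characteristic zero, complete for a non-Archimedean absolute value. $\mathcal{M}(\mathbb{K})$ denotes the field of meromorphic functions in $\mathbb{K}$. A non-constant polynomial $P$ is a UPM in $\mathbb{K}$ if for any two non-constant $f,g\in\mathcal{M}(\mathbb{K})$, the identity $P(f)=P(g)$ implies $f=g$. Definition of $t,t'$. Let $S$ be the set of distinct zeros of $P'$, and for $d\in S$ let $q_d\ge 1$ be the multiplicity of $d$ as a zero of $P'$. Partition $S$ into ''columns'' $C_1,C_2,\dots$, namely the classes of the equivalence relation $d\sim d'\iff P(d)=P(d')$. Let $C_i'$ be the list (with repetitions) of the multiplicities $q_d$, $d\in C_i$. Let $A_i$ be the set of values that occur exactly once in the list $C_i'$. Put $A_i(H_1)=\{q\in A_i: q>q' \text{ for all } q' \text{ in } C_i' \text{ with } q'\notin A_i\}$, $A_i(H_2)=\{q\in A_i(H_1): \max A_i(H_1)+1<2(q+1)\}$, $B_i(H_2)=\{d\in C_i: q_d\in A_i(H_2)\}$. Then $t=|\{i: B_i(H_2)\neq\emptyset\}|$ and $t'=|\bigcup_i B_i(H_2)|$. *)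

(* Defs.v *)
From HB Require Import structures.
From mathcomp Require Import all_boot all_order all_algebra.
From mathcomp Require Import finmap.
From mathcomp Require Import all_classical all_reals all_analysis.

Set Implicit Arguments.
Unset Strict Implicit.
Unset Printing Implicit Defensive.

Import Order.TTheory GRing.Theory Num.Theory.
Import numFieldNormedType.Exports.
Local Open Scope classical_set_scope.
Local Open Scope ring_scope.

(* The trivial absolute value is not excluded. *)
HB.mixin Record isNonArchComplete (R : realType) K of GRing.ClosedField K := {
  absv : K -> R;
  absv_ge0 : forall x, 0 <= absv x;
  absv_eq0 : forall x, (absv x == 0) = (x == 0);
  absvM : forall x y, absv (x * y) = absv x * absv y;
  absv_leD_max : forall x y, absv (x + y) <= Num.max (absv x) (absv y);
  absv_complete : forall u : nat -> K,
    (forall e : R, 0 < e ->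
      exists N, forall m n, (N <= m)%N -> (N <= n)%N -> absv (u m - u n) < e) ->
    exists l, absv (u n - l) @[n --> \oo] --> (0 : R)
}.

#[short(type="nonArchClosedFieldType")]
HB.structure Definition NonArchClosedField (R : realType) :=
  { K of GRing.ClosedField K & isNonArchComplete R K }.

Section NonArchSeries.
Variables (R : realType) (K : nonArchClosedFieldType R).
Local Notation absv := (@absv R K).

Definition na_cvg (u : nat -> K) (l : K) : Prop :=
  absv (u n - l) @[n --> \oo] --> (0 : R).

Lemma absv0 : absv 0 = 0.
Proof. by apply/eqP; rewrite absv_eq0. Qed.

Lemma absvN x : absv (- x) = absv x.
Proof.
apply/eqP; rewrite -(@eqrXn2 _ 2) ?absv_ge0 //.
by rewrite !expr2 -!absvM mulrNN.
Qed.

Lemma na_cvgP u l : na_cvg u l <->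
  forall e : R, 0 < e -> exists N, forall n, (N <= n)%N -> absv (u n - l) < e.
Proof.
split=> [/cvgrPdist_lt ul e e0|ul].
  have [N _ NP] := ul _ e0; exists N => n Nn.
  by have := NP n Nn; rewrite /= sub0r normrN ger0_norm ?absv_ge0.
apply/cvgrPdist_lt => e e0; have [N NP] := ul e e0.
exists N => // n Nn /=; rewrite sub0r normrN ger0_norm ?absv_ge0 //.
exact: NP.
Qed.

Lemma absv_sum_le (e : R) (f : nat -> K) (s : seq nat) :
  0 <= e -> (forall i, i \in s -> absv (f i) <= e) ->
  absv (\sum_(i <- s) f i) <= e.
Proof.
move=> e0 fe; rewrite big_seq_cond; elim/big_ind: _ => [|x y xe ye|i].
- by rewrite absv0.
- by rewrite (le_trans (absv_leD_max _ _)) // ge_max xe.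
- by rewrite andbT; exact: fe.
Qed.

Lemma na_series_cvgP u :
  (exists l, na_cvg (series u) l) <-> na_cvg u 0.
Proof.
split=> [[l /na_cvgP ul]|/na_cvgP u0].
  apply/na_cvgP => e /ul[N NP]; exists N => n Nn; rewrite subr0.
  have -> : u n = (series u n.+1 - l) + - (series u n - l).
    by rewrite opprB subrKA /series /= big_nat_recr //= addrAC subrr add0r.
  by rewrite (le_lt_trans (absv_leD_max _ _)) // absvN gt_max !NP // leqW.
apply: absv_complete => e e0.
have [N NP] := u0 _ (divr_gt0 e0 (ltr0n _ 2)); exists N.
have H m n : (N <= m)%N -> (m <= n)%N -> absv (series u n - series u m) < e.
  move=> Nm mn; rewrite sub_series_geq // /=.
  have e2 : 0 < e / 2 by rewrite divr_gt0.
  rewrite (le_lt_trans (@absv_sum_le (e / 2) _ _ (ltW e2) _)) //.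
    move=> i; rewrite mem_index_iota => /andP[mi _].
    by have := NP i (leq_trans Nm mi); rewrite subr0 => /ltW.
  by rewrite ltr_pdivrMr // mulr_natr mulr2n ltrDl.
move=> m n Nm Nn; have [mn|/ltnW nm] := leqP m n; last exact: H.
by rewrite -absvN opprB; apply: H.
Qed.

Lemma na_cvg0_conv (u v : nat -> K) : na_cvg u 0 -> na_cvg v 0 ->
  na_cvg (fun n => \sum_(i < n.+1) u i * v (n - i)%N) 0.
Proof.
have bnd (w : nat -> K) : na_cvg w 0 ->
    exists2 M : R, 0 < M & forall n, absv (w n) < M.
  move=> /na_cvgP/(_ 1 ltr01)[N NP].
  exists (1 + \sum_(i < N) absv (w i)) => [|n].
    by rewrite ltr_wpDr // sumr_ge0 // => i _; exact: absv_ge0.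
  have [Nn|nN] := leqP N n.
    rewrite (@lt_le_trans _ _ 1) //; first by have := NP n Nn; rewrite subr0.
    by rewrite lerDl sumr_ge0 // => i _; exact: absv_ge0.
  rewrite (bigD1 (Ordinal nN)) //= addrCA ltrDl ltr_wpDr // sumr_ge0 // => i _.
  exact: absv_ge0.
move=> u0 v0; have [M M0 uM] := bnd u u0; have [L L0 vL] := bnd v v0.
move/na_cvgP: u0 => u0; move/na_cvgP: v0 => v0.
apply/na_cvgP => e e0.
have [N NP] := u0 _ (divr_gt0 e0 L0).
have [N' NP'] := v0 _ (divr_gt0 e0 M0).
exists (N + N')%N => n nN; rewrite subr0.
elim/big_ind: _ => [|x y xe ye|i _].
- by rewrite absv0.
- by rewrite (le_lt_trans (absv_leD_max _ _)) // gt_max xe.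
- rewrite absvM; have [Ni|iN] := leqP N i.
    have := NP i Ni; rewrite subr0 => ui.
    rewrite -[e](divfK (lt0r_neq0 L0)).
    by apply: ltr_pM => //; exact: absv_ge0.
  have N'i : (N' <= n - i)%N.
    rewrite leq_subRL; last by rewrite -ltnS.
    by rewrite (leq_trans _ nN) // leq_add2r ltnW.
  have := NP' _ N'i; rewrite subr0 => vi.
  rewrite -[e](divfK (lt0r_neq0 M0)) mulrC.
  by apply: ltr_pM => //; exact: absv_ge0.
Qed.

End NonArchSeries.

(* An entire function is given by its power series, required to converge at   *)
(* every point of K.                                                          *)
Definition entire_coefs (R : realType) (K : nonArchClosedFieldType R)
    (a : nat -> K) : Prop :=
  forall x : K, exists l : K, na_cvg (series (fun n => a n * x ^+ n)) l.

Record entire (R : realType) (K : nonArchClosedFieldType R) := Entire {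
  ecoef :> nat -> K;
  ecoefP : entire_coefs ecoef
}.

Section EntireRing.
Variables (R : realType) (K : nonArchClosedFieldType R).
Local Notation E := (entire K).
Implicit Types f g h : E.

HB.instance Definition _ := gen_eqMixin E.
HB.instance Definition _ := gen_choiceMixin E.

Lemma entireP f g : f =1 g <-> f = g.
Proof.
split=> [|-> //]; case: f g => [a aP] [b bP] /= /funext ab.
by subst b; congr Entire; exact: Prop_irrelevance.
Qed.

Lemma entire_coefsP (a : nat -> K) :
  entire_coefs a <-> forall x : K, na_cvg (fun n => a n * x ^+ n) 0.
Proof. by split=> aP x; apply/na_series_cvgP; exact: aP. Qed.

Lemma entire_const_subproof (c : K) :
  entire_coefs (fun n => if n is 0%N then c else 0).
Proof.
apply/entire_coefsP => x; apply/na_cvgP => e e0; exists 1%N => -[//|n] _.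
by rewrite mul0r subr0 absv0.
Qed.
Definition entire_const c : E := Entire (entire_const_subproof c).

Lemma entire_add_subproof f g : entire_coefs (fun n => f n + g n).
Proof.
apply/entire_coefsP => x; apply/na_cvgP => e e0.
have /entire_coefsP/(_ x)/na_cvgP/(_ e e0)[N NP] := ecoefP f.
have /entire_coefsP/(_ x)/na_cvgP/(_ e e0)[M MP] := ecoefP g.
exists (maxn N M) => n; rewrite geq_max => /andP[/NP Nn /MP Mn].
move: Nn Mn; rewrite !subr0 => Nn Mn; rewrite mulrDl.
by rewrite (le_lt_trans (absv_leD_max _ _)) // gt_max Nn.
Qed.
Definition entire_add f g : E := Entire (entire_add_subproof f g).

Lemma entire_opp_subproof f : entire_coefs (fun n => - f n).
Proof.
apply/entire_coefsP => x; apply/na_cvgP => e e0.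
have /entire_coefsP/(_ x)/na_cvgP/(_ e e0)[N NP] := ecoefP f.
by exists N => n /NP; rewrite !subr0 mulNr absvN.
Qed.
Definition entire_opp f : E := Entire (entire_opp_subproof f).

Lemma entire_mul_subproof f g :
  entire_coefs (fun n => \sum_(i < n.+1) f i * g (n - i)%N).
Proof.
apply/entire_coefsP => x.
have /entire_coefsP/(_ x) fx := ecoefP f.
have /entire_coefsP/(_ x) gx := ecoefP g.
have := na_cvg0_conv fx gx; congr (na_cvg _ 0); apply/funext => n.
rewrite mulr_suml; apply: eq_bigr => i _.
by rewrite mulrACA -exprD subnKC // -ltnS.
Qed.
Definition entire_mul f g : E := Entire (entire_mul_subproof f g).

Fact entire_addA : associative entire_add.
Proof. by move=> f g h; apply/entireP => n /=; rewrite addrA. Qed.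
Fact entire_addC : commutative entire_add.
Proof. by move=> f g; apply/entireP => n /=; rewrite addrC. Qed.
Fact entire_add0 : left_id (entire_const 0) entire_add.
Proof. by move=> f; apply/entireP => -[|n] /=; rewrite add0r. Qed.
Fact entire_addN : left_inverse (entire_const 0) entire_opp entire_add.
Proof. by move=> f; apply/entireP => -[|n] /=; rewrite addNr. Qed.

HB.instance Definition _ := GRing.isZmodule.Build E
  entire_addA entire_addC entire_add0 entire_addN.

Let trunc m f : {poly K} := \poly_(i < m) f i.

Let mul_trunc m n f g : (n < m)%N ->
  entire_mul f g n = (trunc m f * trunc m g)`_n.
Proof.
move=> nm; rewrite coefM /=; apply: eq_bigr => i _; rewrite !coef_poly.
by rewrite (leq_ltn_trans _ nm) ?(leq_ltn_trans _ nm) ?leq_subr // -ltnS.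
Qed.

Fact entire_mulA : associative entire_mul.
Proof.
move=> f g h; apply/entireP => n; rewrite !(@mul_trunc n.+1) //.
have eqM (p q r s : {poly K}) :
    (forall i, (i < n.+1)%N -> p`_i = q`_i) ->
    (forall i, (i < n.+1)%N -> r`_i = s`_i) -> (p * r)`_n = (q * s)`_n.
  move=> pq rs; rewrite !coefM; apply: eq_bigr => i _.
  by rewrite pq ?rs // ltnS leq_subr.
transitivity ((trunc n.+1 f * (trunc n.+1 g * trunc n.+1 h))`_n).
  apply: eqM => // i ni; rewrite [LHS]coef_poly ni; exact: mul_trunc.
rewrite mulrA; apply: eqM => // i ni; rewrite [RHS]coef_poly ni.
by apply/esym; exact: mul_trunc.
Qed.
Fact entire_mulC : commutative entire_mul.
Proof.
by move=> f g; apply/entireP => n; rewrite !(@mul_trunc n.+1) // mulrC.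
Qed.
Fact entire_mul1 : left_id (entire_const 1) entire_mul.
Proof.
move=> f; apply/entireP => n /=; rewrite big_ord_recl /= mul1r subn0.
by rewrite big1 ?addr0 // => i _; rewrite mul0r.
Qed.
Fact entire_mulDl : left_distributive entire_mul entire_add.
Proof.
move=> f g h; apply/entireP => n /=; rewrite -big_split /=.
by apply: eq_bigr => i _; rewrite mulrDl.
Qed.
Fact entire_1neq0 : entire_const 1 != 0 :> E.
Proof.
by apply/eqP => /(congr1 (fun f : E => f 0%N)) /= /eqP; rewrite oner_eq0.
Qed.

HB.instance Definition _ := GRing.Zmodule_isComNzRing.Build E
  entire_mulA entire_mulC entire_mul1 entire_mulDl entire_1neq0.

Definition entire_unit : {pred E} := [pred f | `[< exists g, g * f = 1 >]].
Definition entire_inv f : E :=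
  if pselect (exists g, g * f = 1) is left ex then sval (cid ex) else f.

Fact entire_mulVx : {in entire_unit, left_inverse 1 entire_inv *%R}.
Proof.
move=> f /asboolP ex; rewrite /entire_inv.
by case: pselect => // ex1; exact (svalP (cid ex1)).
Qed.
Fact entire_unitPl f g : g * f = 1 -> entire_unit f.
Proof. by move=> gf; apply/asboolP; exists g. Qed.
Fact entire_invr_out : {in [predC entire_unit], entire_inv =1 id}.
Proof.
move=> f /asboolPn nex; rewrite /entire_inv.
by case: pselect.
Qed.

HB.instance Definition _ := GRing.ComNzRing_hasMulInverse.Build E
  entire_mulVx entire_unitPl entire_invr_out.

Fact entire_integral : GRing.integral_domain_axiom E.
Proof.
move=> f g fg0; apply/norP => -[f0 g0].
have ex h : h != 0 -> exists n, h n != 0.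
  move=> h0; apply: contrapT => nex; move/eqP: h0; apply; apply/entireP => n.
  have -> : (0 : E) n = 0 by case: n.
  by apply: contrapT => /eqP hn; apply: nex; exists n.
case: (ex_minnP (ex f f0)) => m fm mP; case: (ex_minnP (ex g g0)) => n gn nP.
have : (f * g) (m + n)%N = 0 by rewrite fg0; case: (m + n)%N.
rewrite /=; have mlt : (m < (m + n).+1)%N by rewrite ltnS leq_addr.
rewrite (bigD1 (Ordinal mlt)) //= big1 => [|i im].
  by rewrite addr0 addKn => /eqP; rewrite mulf_eq0 (negPf fm) (negPf gn).
have [mi|im'] := ltnP m i.
  suff -> : g (m + n - i)%N = 0 by rewrite mulr0.
  apply/eqP; apply: contraLR mi => /nP nmi; rewrite -leqNgt.
  have ile : (i <= m + n)%N by rewrite -ltnS.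
  by move: nmi; rewrite leq_subRL // leq_add2r.
suff -> : f i = 0 by rewrite mul0r.
apply/eqP; apply: contraNT im => /mP mi.
by rewrite -val_eqE /= eqn_leq im' mi.
Qed.

HB.instance Definition _ := GRing.ComUnitRing_isIntegral.Build E
  entire_integral.

End EntireRing.

Definition meromorphic (R : realType) (K : nonArchClosedFieldType R) :=
  {fraction entire K}.

Definition mero_const (R : realType) (K : nonArchClosedFieldType R) (c : K) :
  meromorphic K := tofrac (entire_const c).

Definition mero_nonconstant (R : realType) (K : nonArchClosedFieldType R)
  (f : meromorphic K) : Prop := forall c : K, f <> mero_const c.

Definition UPM (R : realType) (K : nonArchClosedFieldType R) (P : {poly K}) :
    Prop :=
  (1 < size P)%N /\
  forall f g : meromorphic K, mero_nonconstant f -> mero_nonconstant g ->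
    (map_poly (@mero_const R K) P).[f] = (map_poly (@mero_const R K) P).[g] ->
    f = g.

Section CriticalColumns.
Local Open Scope fset_scope.
Variables (K : closedFieldType) (P : {poly K}).

(* [fset_set] of an infinite set is empty: this is the value for constant P.  *)
Definition crit : {fset K} := fset_set [set d | root P^`() d]%classic.

Definition crit_mult (d : K) : nat := mup d P^`().

Definition column (d : K) : {fset K} := [fset e in crit | P.[e] == P.[d]].

Definition columns : {fset {fset K}} := [fset column d | d in crit].

Definition col_mults (C : {fset K}) : seq nat :=
  [seq crit_mult d | d <- enum_fset C].

Definition col_A (C : {fset K}) : seq nat :=
  [seq q <- col_mults C | count_mem q (col_mults C) == 1%N].

Definition col_A_H1 (C : {fset K}) : seq nat :=
  [seq q <- col_A C |
     all (fun q' => (q' \notin col_A C) ==> (q' < q)%N) (col_mults C)].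

Definition col_A_H2 (C : {fset K}) : seq nat :=
  [seq q <- col_A_H1 C | ((\max_(p <- col_A_H1 C) p) + 1 < 2 * (q + 1))%N].

Definition col_B_H2 (C : {fset K}) : {fset K} :=
  [fset d in C | crit_mult d \in col_A_H2 C].

Definition t_num : nat := #|` [fset C in columns | col_B_H2 C != fset0] |.

Definition t'_num : nat := #|` \bigcup_(C <- columns) col_B_H2 C |.

End CriticalColumns.

(* Main.v *)
From HB Require Import structures.
Require Import Defs.
From mathcomp Require Import all_boot all_order all_algebra.
From mathcomp Require Import finmap.
From mathcomp Require Import all_classical all_reals all_analysis.
From mathcomp Require Import ring lra zify.

(** Write [f = F / G] and [g = F' / G'] with entire functions, and suppose that
[P(f) = P(g)].  Among the multiplicities selected in a column the largest one
always satisfies the second condition; hence [3 <= t_num P] says that [P] has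
three critical points [d1], [d2], [d3], with different values of [P], each of
which is the unique point of maximal multiplicity in its fibre of [P].

Consider [h = f' g' (f - g)^2 / prod_i (f - d_i) (g - d_i)].

Locally, [h] has no pole.  At a common zero of [f - d_i] and [g - d_i] the two
multiplicities agree, and the factor [(f - g)^2] compensates the simple poles of
the two logarithmic derivatives.  If [f] takes the value [d_i] with multiplicity
[k] where [g] takes another value [e], then [e] lies in the same fibre with a
smaller multiplicity, so that [g] takes it with a multiplicity greater than [k];
the zero of [g'] then compensates the pole.  At a common pole the degrees
suffice.  This is the combinatorial lemma [position_inequality].

Globally, the Gauss norm of radius [r] is a multiplicative norm for which
[r |f'| <= |f - c|] for each constant [c].  At most one of the four quantities
[f - d_i] and [1 / f] is small, so [h] is [O(r^-2)] ([gauss_wronskian_four]).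

A quotient of entire functions without poles has a nondecreasing Gauss norm
([gauss_quotient_homo]): common zeros can be divided out, because an entire
function whose dominant coefficient in a disc is not the constant one vanishes
somewhere in that disc ([zero_exists]).  Hence [h = 0], and as [f] and [g] are
not constant, [f = g].

All this is done with the homogeneous expressions [num] and [den] in [F], [G],
[F'], [G'], which treat poles as a fourth value.  The argument is uniform in the
absolute value, trivial or not. *)

Set Implicit Arguments.
Unset Strict Implicit.
Unset Printing Implicit Defensive.

Import Order.TTheory GRing.Theory Num.Theory.
Local Open Scope ring_scope.

(** * Absolute values *)

Section AbsoluteValue.
Variables (R : realType) (K : nonArchClosedFieldType R).
Local Notation v := (@absv R K).

Lemma absv_gt0 x : (0 < v x) = (x != 0).
Proof. by rewrite lt_def absv_ge0 absv_eq0 andbT. Qed.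

Lemma absv1 : v 1 = 1.
Proof.
have v1 : v 1 != 0 by rewrite absv_eq0 oner_eq0.
by apply: (mulfI v1); rewrite -absvM !mulr1.
Qed.

Lemma absvX x n : v (x ^+ n) = v x ^+ n.
Proof. by elim: n => [|n IH]; rewrite ?absv1 // !exprS absvM IH. Qed.

Lemma absvV x : v x^-1 = (v x)^-1.
Proof.
have [->|x0] := eqVneq x 0; first by rewrite invr0 absv0 invr0.
have vx : v x != 0 by rewrite absv_eq0.
by apply: (mulfI vx); rewrite -absvM !divff // absv1.
Qed.

Lemma absv_nat_le1 n : v n%:R <= 1.
Proof.
elim: n => [|n IH]; first by rewrite absv0.
rewrite -natr1 (le_trans (absv_leD_max _ _)) // ge_max IH absv1 /=.
by rewrite lexx.
Qed.

Lemma absvB_max x y : v (x - y) <= Num.max (v x) (v y).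
Proof. by rewrite (le_trans (absv_leD_max _ _)) // absvN. Qed.

Lemma absvD_dominant x y : v y < v x -> v (x + y) = v x.
Proof.
move=> yx; apply/eqP; rewrite eq_le; apply/andP; split.
  by rewrite (le_trans (absv_leD_max _ _)) // ge_max lexx ltW.
rewrite leNgt; apply/negP => xyx.
have := absvB_max (x + y) y; rewrite addrK => /le_lt_trans; move/(_ (v x)).
by rewrite gt_max xyx yx ltxx => /(_ isT).
Qed.

Lemma absv_sum_lt (I : Type) (s : seq I) (P : pred I) (f : I -> K) (e : R) :
  0 < e -> (forall i, P i -> v (f i) < e) -> v (\sum_(i <- s | P i) f i) < e.
Proof.
move=> e0 fe; elim/big_ind: _ => // [|x y xe ye]; first by rewrite absv0.
by rewrite (le_lt_trans (absv_leD_max _ _)) // gt_max xe.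
Qed.

End AbsoluteValue.

(** * The Gauss norm of an entire function *)

Section GaussNorm.
Variables (R : realType) (K : nonArchClosedFieldType R).
Local Notation v := (@absv R K).
Local Notation E := (entire K).
Implicit Types (F G H : E) (r s : R).

Lemma ecoef0 n : (0 : E) n = 0. Proof. by case: n. Qed.
Lemma ecoefD F G n : (F + G) n = F n + G n. Proof. by []. Qed.
Lemma ecoefN F n : (- F) n = - F n. Proof. by []. Qed.
Lemma ecoefB F G n : (F - G) n = F n - G n. Proof. by []. Qed.
Lemma ecoefM F G n : (F * G) n = \sum_(i < n.+1) F i * G (n - i)%N.
Proof. by []. Qed.
Lemma ecoefC c n : @entire_const R K c n = if n is 0%N then c else 0.
Proof. by []. Qed.

Lemma ecoefCM c F n : (entire_const c * F) n = c * F n.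
Proof.
rewrite ecoefM big_ord_recl /= subn0 big1 ?addr0 // => i _.
by rewrite mul0r.
Qed.

Lemma entire_neq0 F : F != 0 -> exists n, F n != 0.
Proof.
move=> F0; apply: contrapT => nF; case/eqP: F0; apply/entireP => n.
by rewrite ecoef0; apply: contrapT => /eqP Fn; apply: nF; exists n.
Qed.

(** The radius need not be the absolute value of a point.  If no point of [K]
has absolute value at least [r], the absolute value is trivial, and then an
entire function is a polynomial. *)
Lemma gauss_terms_cvg0 F r : 0 < r -> forall e : R, 0 < e ->
  exists N, forall n, (N <= n)%N -> v (F n) * r ^+ n < e.
Proof.
move=> r0 e e0; have /entire_coefsP FP := ecoefP F.
have [[x rx]|nx] := pselect (exists x, r <= v x).
  have /na_cvgP/(_ e e0)[N NP] := FP x; exists N => n /NP.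
  rewrite subr0 absvM absvX; apply: le_lt_trans.
  by rewrite ler_wpM2l ?absv_ge0 // lerXn2r // nnegrE ?absv_ge0 ?ltW.
have v_le1 x : v x <= 1.
  rewrite leNgt; apply/negP => x1; apply: nx.
  have h0 : 0 < v x - 1 by rewrite subr_gt0.
  have bernoulli n : 1 + n%:R * (v x - 1) <= v x ^+ n.
    elim: n => [|n IH]; first by rewrite mul0r addr0.
    rewrite exprSr; apply: le_trans (_ : (1 + n%:R * (v x - 1)) * v x <= _).
      rewrite -natr1 -subr_ge0; set a := n%:R : R; set b := v x.
      have -> : (1 + a * (b - 1)) * b - (1 + (a + 1) * (b - 1)) =
                a * (b - 1) ^+ 2 by ring.
      by rewrite mulr_ge0 // ?ler0n // sqr_ge0.
    by rewrite ler_wpM2r ?absv_ge0.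
  exists (x ^+ (Num.bound (r / (v x - 1)))); rewrite absvX.
  apply: le_trans (bernoulli _); rewrite ler_wpDl //.
  by rewrite -ler_pdivrMr // ltW // archi_boundP // divr_ge0 // ltW.
have /na_cvgP/(_ 1 ltr01)[N NP] := FP 1; exists N => n /NP.
rewrite expr1n mulr1 subr0 => Fn1.
have [->|Fn0] := eqVneq (F n) 0; first by rewrite absv0 mul0r.
by have := v_le1 (F n)^-1; rewrite absvV invf_le1 ?absv_gt0 // leNgt Fn1.
Qed.

(** Taking the last index among those of the maximal terms makes [k] the number
of zeros of [F] in the closed disc of radius [r], the boundary included. *)
Definition dominant F r k :=
  [/\ F k != 0, forall n, v (F n) * r ^+ n <= v (F k) * r ^+ k
    & forall n, (k < n)%N -> v (F n) * r ^+ n < v (F k) * r ^+ k].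

Lemma dominant_exists F r : 0 < r -> F != 0 -> exists k, dominant F r k.
Proof.
move=> r0 /entire_neq0[n0 Fn0]; pose a n := v (F n) * r ^+ n.
have a0 : 0 < a n0 by rewrite mulr_gt0 ?absv_gt0 // exprn_gt0.
have [N NP] := gauss_terms_cvg0 F r0 a0.
have n0N : (n0 < N)%N by rewrite ltnNge; apply/negP => /NP; rewrite ltxx.
pose Q k := (k < N)%N && [forall i : 'I_N, a i <= a k].
have exQ : exists k, Q k.
  have [k _ kP] := @Order.TotalTheory.arg_maxP _ R _ (Ordinal n0N) predT
    (fun i : 'I_N => a i) isT.
  by exists k; rewrite /Q ltn_ord; apply/forallP => i; exact: kP.
have ubQ k : Q k -> (k <= N)%N by case/andP => /ltnW.
case: (ex_maxnP exQ ubQ) => k /andP[kN /forallP kP] kmax; exists k.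
have n0k : a n0 <= a k by have := kP (Ordinal n0N).
have ak n : a n <= a k.
  have [Nn|nN] := leqP N n; last by have := kP (Ordinal nN).
  by rewrite (le_trans _ n0k) // ltW // NP.
split=> // [|n kn].
  by apply: contraTneq (lt_le_trans a0 n0k); rewrite /a => ->;
    rewrite absv0 mul0r ltxx.
have [Nn|nN] := leqP N n; first by rewrite (lt_le_trans _ n0k) // NP.
rewrite lt_neqAle ak andbT; apply/negP => /eqP akn; move: kn.
rewrite ltnNge kmax // /Q nN; apply/forallP => i.
by rewrite /a akn; exact: ak.
Qed.

Lemma dominant_unique F r k l : dominant F r k -> dominant F r l -> k = l.
Proof.
move=> [_ ka kb] [_ la lb]; case: (ltngtP k l) => // [/kb|/lb].
  by rewrite ltNge (la k).
by rewrite ltNge (ka l).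
Qed.

Definition gidx F r : nat := xget 0%N [set k | dominant F r k]%classic.

(** The supremum of the [|F n| r^n], which is attained. *)
Definition gauss F r : R := v (F (gidx F r)) * r ^+ gidx F r.

Lemma gidxP F r : 0 < r -> F != 0 -> dominant F r (gidx F r).
Proof. by move=> r0 F0; apply: xgetPex; exact: dominant_exists. Qed.

Lemma gidxE F r k : dominant F r k -> gidx F r = k.
Proof.
move=> Fk; apply: xget_unique => // l Fl.
by apply: dominant_unique Fl Fk.
Qed.

Lemma gauss_ge0 F r : 0 < r -> 0 <= gauss F r.
Proof. by move=> r0; rewrite mulr_ge0 ?absv_ge0 // exprn_ge0 // ltW. Qed.

Lemma gauss0 r : gauss 0 r = 0.
Proof. by rewrite /gauss ecoef0 absv0 mul0r. Qed.

Lemma gauss_gt0 F r : 0 < r -> F != 0 -> 0 < gauss F r.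
Proof.
by move=> r0 /(gidxP r0)[Fk _ _]; rewrite mulr_gt0 ?absv_gt0 ?exprn_gt0.
Qed.

Lemma coef_le_gauss F r n : 0 < r -> v (F n) * r ^+ n <= gauss F r.
Proof.
move=> r0; have [->|/(gidxP r0)[_ + _]] := eqVneq F 0; last by apply.
by rewrite ecoef0 absv0 mul0r gauss0.
Qed.

Lemma gauss_le F r e : (forall n, v (F n) * r ^+ n <= e) -> gauss F r <= e.
Proof. by apply. Qed.

Lemma gaussN F r : 0 < r -> gauss (- F) r = gauss F r.
Proof.
move=> r0; apply/eqP; rewrite eq_le.
apply/andP; split; apply: gauss_le => n.
  by rewrite ecoefN absvN coef_le_gauss.
by rewrite -absvN -ecoefN coef_le_gauss.
Qed.

Lemma gaussD F G r : 0 < r ->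
  gauss (F + G) r <= Num.max (gauss F r) (gauss G r).
Proof.
move=> r0; apply: gauss_le => n; rewrite ecoefD.
apply: le_trans (_ : Num.max (v (F n)) (v (G n)) * r ^+ n <= _).
  by rewrite ler_wpM2r ?absv_leD_max // exprn_ge0 // ltW.
by case: (leP (v (F n)) (v (G n))) => _; rewrite le_max coef_le_gauss ?orbT.
Qed.

Lemma gaussB F G r : 0 < r ->
  gauss (F - G) r <= Num.max (gauss F r) (gauss G r).
Proof. by move=> r0; rewrite (le_trans (gaussD _ _ r0)) // gaussN. Qed.

(** Gauss's lemma: in the Cauchy product at index [k + l], the product of the
two dominant terms strictly dominates all the others. *)
Lemma dominantM F G r k l : 0 < r ->
    dominant F r k -> dominant G r l ->
  dominant (F * G) r (k + l) /\ v ((F * G) (k + l)%N) = v (F k) * v (G l).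
Proof.
move=> r0 [Fk Fle Flt] [Gl Gle Glt].
have rn0 n : 0 < r ^+ n by rewrite exprn_gt0.
set M := v (F k) * r ^+ k in Fle Flt; set L := v (G l) * r ^+ l in Gle Glt.
have M0 : 0 < M by rewrite mulr_gt0 // absv_gt0.
have L0 : 0 < L by rewrite mulr_gt0 // absv_gt0.
have term i n : (i <= n)%N -> v (F i * G (n - i)%N) * r ^+ n =
    (v (F i) * r ^+ i) * (v (G (n - i)%N) * r ^+ (n - i)).
  by move=> i_n; rewrite absvM mulrACA -exprD subnKC.
have pos H i : 0 <= v (H i) * r ^+ i by rewrite mulr_ge0 ?absv_ge0 // ltW.
have ltML i n : (i <= n)%N -> (k < i)%N || (l < n - i)%N ->
    v (F i * G (n - i)%N) * r ^+ n < M * L.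
  move=> i_n; rewrite term // => /orP[/Flt ki|/Glt li].
    apply: le_lt_trans (_ : (v (F i) * r ^+ i) * L < _).
      by rewrite ler_wpM2l.
    by rewrite ltr_pM2r.
  apply: le_lt_trans (_ : M * (v (G (n - i)%N) * r ^+ (n - i)) < _).
    by rewrite ler_wpM2r.
  by rewrite ltr_pM2l.
have kln : v (F k) * v (G l) * r ^+ (k + l) = M * L by rewrite exprD mulrACA.
have top : v ((F * G) (k + l)%N) = v (F k) * v (G l).
  have klt : (k < (k + l).+1)%N by rewrite ltnS leq_addr.
  rewrite ecoefM (bigD1 (Ordinal klt)) //= addKn -absvM.
  apply: absvD_dominant; apply: absv_sum_lt => [|i ik].
    by rewrite absv_gt0 mulf_neq0.
  rewrite -(ltr_pM2r (rn0 (k + l)%N)) (absvM (F k)) kln.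
  have ile : (i <= k + l)%N by rewrite -ltnS.
  apply: ltML => //.
  case: (ltngtP i k) => // [ki|ik']; first by rewrite ltn_subRL ltn_add2r ki.
  by case/eqP: ik; apply: val_inj.
have bnd e n : 0 < e ->
    (forall i, (i <= n)%N -> v (F i * G (n - i)%N) * r ^+ n < e) ->
    v ((F * G) n) * r ^+ n < e.
  move=> e0 lte; rewrite -ltr_pdivlMr //; apply: absv_sum_lt => [|i _].
    by rewrite divr_gt0.
  by rewrite ltr_pdivlMr // lte // -ltnS.
have gtkl n : (k + l < n)%N -> v ((F * G) n) * r ^+ n < M * L.
  move=> kln'; apply: bnd => [|i i_n]; first by rewrite mulr_gt0.
  apply: ltML => //; case: (ltnP k i) => //= ik.
  by rewrite ltn_subRL (leq_ltn_trans _ kln') // leq_add2r.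
split=> //; split=> [|n|n].
- by rewrite -absv_eq0 top mulf_neq0 ?absv_eq0.
- rewrite top kln; rewrite leNgt; apply/negP => lt.
  suff : v ((F * G) n) * r ^+ n < v ((F * G) n) * r ^+ n by rewrite ltxx.
  apply: bnd => [|i i_n]; first by apply: lt_trans lt; rewrite mulr_gt0.
  by apply: le_lt_trans lt; rewrite term // ler_pM.
- by move=> /gtkl; rewrite top kln.
Qed.

Lemma gidxM F G r : 0 < r -> F != 0 -> G != 0 ->
  gidx (F * G) r = (gidx F r + gidx G r)%N.
Proof.
move=> r0 F0 G0; apply: gidxE.
by have [] := dominantM r0 (gidxP r0 F0) (gidxP r0 G0).
Qed.

Lemma gaussM F G r : 0 < r -> gauss (F * G) r = gauss F r * gauss G r.
Proof.
move=> r0; have [->|F0] := eqVneq F 0; first by rewrite mul0r gauss0 mul0r.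
have [->|G0] := eqVneq G 0; first by rewrite mulr0 gauss0 mulr0.
have [_ top] := dominantM r0 (gidxP r0 F0) (gidxP r0 G0).
by rewrite {1}/gauss gidxM // top exprD mulrACA.
Qed.

Lemma gaussC c r : 0 < r -> gauss (entire_const c) r = v c.
Proof.
move=> r0; apply/eqP; rewrite eq_le.
have := coef_le_gauss (entire_const c) 0 r0; rewrite expr0 mulr1 => ->.
rewrite andbT; apply: gauss_le => -[|n]; rewrite ecoefC ?expr0 ?mulr1 //.
by rewrite absv0 mul0r absv_ge0.
Qed.

Lemma gauss_homo F r s : 0 < s -> s <= r -> gauss F s <= gauss F r.
Proof.
move=> s0 sr; apply: gauss_le => n.
apply: le_trans (coef_le_gauss F n (lt_le_trans s0 sr)).
by rewrite ler_wpM2l ?absv_ge0 // lerXn2r // nnegrE ltW // (lt_le_trans s0).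
Qed.

(** Without zeros in the disc, the constant term dominates at every smaller
radius. *)
Lemma gauss_gidx0 F r s : 0 < s -> s <= r -> gidx F r = 0%N ->
  gauss F s = gauss F r.
Proof.
move=> s0 sr Fr; apply/eqP; rewrite eq_le gauss_homo //=.
by rewrite {1}/gauss Fr expr0 mulr1 -(mulr1 (v _)) -(expr0 s) coef_le_gauss.
Qed.

End GaussNorm.

(** * Derivation *)

Section Derivation.
Variables (R : realType) (K : nonArchClosedFieldType R).
Local Notation v := (@absv R K).
Local Notation E := (entire K).
Implicit Types (F G H : E) (r s : R).

Lemma entire_deriv_subproof F : entire_coefs (fun n => n.+1%:R * F n.+1).
Proof.
apply/entire_coefsP => x; apply/na_cvgP => e e0.
have [->|x0] := eqVneq x 0.
  by exists 1%N => -[//|n] _; rewrite expr0n mulr0 subr0 absv0.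
have vx0 : 0 < v x by rewrite absv_gt0.
have /entire_coefsP/(_ x)/na_cvgP/(_ (e * v x)) := ecoefP F.
rewrite mulr_gt0 // => /(_ isT)[N NP]; exists N => n Nn.
have := NP n.+1 (leqW Nn); rewrite !subr0 exprSr mulrA (absvM _ x).
rewrite ltr_pM2r //; apply: le_lt_trans; rewrite -mulrA absvM.
by rewrite ler_piMl ?absv_ge0 // absv_nat_le1.
Qed.

Definition entire_deriv F : E := Entire (entire_deriv_subproof F).

Lemma ecoef_deriv F n : entire_deriv F n = n.+1%:R * F n.+1.
Proof. by []. Qed.

Lemma entire_derivCM c F :
  entire_deriv (entire_const c * F) = entire_const c * entire_deriv F.
Proof. by apply/entireP => n; rewrite ecoefCM !ecoef_deriv ecoefCM mulrCA. Qed.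

Lemma entire_derivM F G :
  entire_deriv (F * G) = entire_deriv F * G + F * entire_deriv G.
Proof.
apply/entireP => n; rewrite ecoefD !ecoefM ecoef_deriv ecoefM mulr_sumr.
transitivity (\sum_(i < n.+2) (i%:R * F i * G (n.+1 - i)%N +
                 F i * ((n.+1 - i)%:R * G (n.+1 - i)%N))).
  apply: eq_bigr => i _; have i_n : (i <= n.+1)%N by rewrite -ltnS.
  have -> : n.+1%:R = i%:R + (n.+1 - i)%:R :> K by rewrite -natrD subnKC.
  by ring.
rewrite big_split /=; congr (_ + _).
  rewrite big_ord_recl /= !mul0r add0r; apply: eq_bigr => i _.
  by rewrite /bump leq0n add1n subSS.
rewrite big_ord_recr /= subnn mul0r mulr0 addr0; apply: eq_bigr => i _.
by rewrite subSn // -ltnS.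
Qed.

Lemma gauss_deriv F r : 0 < r -> gauss (entire_deriv F) r * r <= gauss F r.
Proof.
move=> r0; rewrite -ler_pdivlMr //; apply: gauss_le => n.
rewrite ler_pdivlMr // -mulrA -exprSr ecoef_deriv.
apply: le_trans (coef_le_gauss F n.+1 r0).
rewrite ler_wpM2r ?exprn_ge0 ?(ltW r0) // absvM.
by rewrite ler_piMl ?absv_ge0 // absv_nat_le1.
Qed.

End Derivation.

(** * Values of entire functions and division by a linear factor *)

Section Evaluation.
Variables (R : realType) (K : nonArchClosedFieldType R).
Local Notation v := (@absv R K).
Local Notation E := (entire K).
Implicit Types (F G H Q : E) (r s : R) (a x : K).

Lemma na_cvg_unique (u : nat -> K) l l' : na_cvg u l -> na_cvg u l' -> l = l'.
Proof.
move=> /na_cvgP ul /na_cvgP ul'; apply/eqP; rewrite -subr_eq0 -absv_eq0.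
apply: contrapT => /negP ll'.
have e0 : 0 < v (l - l') by rewrite lt_def ll' absv_ge0.
have [N NP] := ul _ e0; have [N' NP'] := ul' _ e0.
have := absvB_max (u (maxn N N') - l') (u (maxn N N') - l).
rewrite (_ : _ - (_ - l) = l - l'); last by ring.
by rewrite leNgt gt_max NP' ?NP ?leq_maxl ?leq_maxr.
Qed.

Definition eval F a : K := sval (cid (ecoefP F a)).

Lemma evalP F a : na_cvg (series (fun n => F n * a ^+ n)) (eval F a).
Proof. exact: svalP (cid (ecoefP F a)). Qed.

Lemma eval_le F a (e : R) : 0 <= e -> (forall n, v (F n * a ^+ n) <= e) ->
  v (eval F a) <= e.
Proof.
move=> e0 Fe; rewrite leNgt; apply/negP => lt_e.
have /na_cvgP/(_ _ (le_lt_trans e0 lt_e))[N /(_ N (leqnn N)) NP] := evalP F a.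
have := absvB_max (series (fun n => F n * a ^+ n) N)
  (series (fun n => F n * a ^+ n) N - eval F a).
rewrite opprB addrC subrK leNgt gt_max NP andbT => /negP; apply.
by apply: le_lt_trans lt_e; apply: absv_sum_le.
Qed.

Lemma entire_shift_subproof F : entire_coefs (fun n => F n.+1).
Proof.
apply/entire_coefsP => x; apply/na_cvgP => e e0.
have [->|x0] := eqVneq x 0.
  by exists 1%N => -[//|n] _; rewrite expr0n mulr0 subr0 absv0.
have vx0 : 0 < v x by rewrite absv_gt0.
have /entire_coefsP/(_ x)/na_cvgP/(_ (e * v x)) := ecoefP F.
rewrite mulr_gt0 // => /(_ isT)[N NP]; exists N => n Nn.
have := NP n.+1 (leqW Nn); rewrite !subr0 exprSr mulrA (absvM _ x).
by rewrite ltr_pM2r.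
Qed.

Definition entire_shift F : E := Entire (entire_shift_subproof F).

Lemma iter_shiftE F m n : iter m entire_shift F n = F (m + n)%N.
Proof.
elim: m n => [//|m IH] n; rewrite iterS.
by transitivity (iter m entire_shift F n.+1) => //; rewrite IH addnS.
Qed.

Lemma eval_shift F a : eval F a = F 0%N + a * eval (entire_shift F) a.
Proof.
apply: na_cvg_unique (evalP F a) _; apply/na_cvgP => e e0.
have d0 : 0 < e / (1 + v a).
  by rewrite divr_gt0 // ltr_pwDl // absv_ge0.
have /na_cvgP/(_ _ d0)[N NP] := evalP (entire_shift F) a.
exists N.+1 => -[//|n]; rewrite ltnS => /NP.
rewrite /series /= big_nat_recl // expr0 mulr1 opprD addrACA subrr add0r.
under [in X in _ -> X]eq_bigr do rewrite exprS mulrCA.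
rewrite -mulr_sumr -mulrBr absvM ltr_pdivlMr ?ltr_pwDl ?absv_ge0 //.
apply: le_lt_trans; rewrite mulrC ler_wpM2l ?absv_ge0 //.
by rewrite lerDr.
Qed.

Definition entire_poly_subproof (p : {poly K}) :
  entire_coefs (fun n => p`_n).
Proof.
apply/entire_coefsP => x; apply/na_cvgP => e e0; exists (size p) => n sn.
by rewrite nth_default // mul0r subr0 absv0.
Qed.

Definition entire_poly (p : {poly K}) : E := Entire (entire_poly_subproof p).

Lemma entire_polyM p q : entire_poly (p * q) = entire_poly p * entire_poly q.
Proof. by apply/entireP => n; rewrite ecoefM /= coefM. Qed.

Lemma entire_polyC c : entire_poly c%:P = entire_const c.
Proof. by apply/entireP => -[|n] /=; rewrite coefC. Qed.

Definition zsub a : E := entire_poly ('X - a%:P).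

Lemma zsubM0 a F : (zsub a * F) 0%N = - (a * F 0%N).
Proof.
by rewrite ecoefM big_ord1 /= subn0 coefB coefX coefC sub0r mulNr.
Qed.

Lemma zsubMS a F n : (zsub a * F) n.+1 = F n - a * F n.+1.
Proof.
rewrite ecoefM big_ord_recl big_ord_recl big1 => [|i _].
  rewrite /= addr0 !coefB !coefX !coefC /= sub0r subr0 mul1r subn0.
  by rewrite mulNr addrC /bump /= add1n subSS subn0.
by rewrite /= coefB coefX coefC /= subr0 mul0r.
Qed.

Lemma zsub_neq0 a : zsub a != 0.
Proof.
apply/eqP => /(congr1 (fun F : E => F 1%N)); rewrite ecoef0 /=.
by rewrite coefB coefX coefC subr0 => /eqP; rewrite oner_eq0.
Qed.

(** Division by [z - a] with remainder the value at [a].  The quotient has the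
values at [a] of the shifted series as coefficients, and these are bounded by
the terms of the series on any disc containing [a]. *)
Lemma entire_remainder F a :
  exists Q, F = zsub a * Q + entire_const (eval F a).
Proof.
pose q n := eval (iter n.+1 entire_shift F) a.
have qP : entire_coefs q.
  apply/entire_coefsP => x; apply/na_cvgP => e e0.
  (* The terms at [y] bound those at [a] and those at [x]. *)
  pose y := if v a <= v x then x else a.
  have [ay xy] : v a <= v y /\ v x <= v y.
    by rewrite /y; case: (leP (v a) (v x)) => [//|/ltW].
  have e20 : 0 < e / 2 by rewrite divr_gt0.
  have /entire_coefsP/(_ y)/na_cvgP/(_ _ e20)[N NP] := ecoefP (entire_shift F).
  exists N => n Nn; rewrite subr0 absvM.
  have [->|x0] := eqVneq (v (x ^+ n)) 0; first by rewrite mulr0.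
  have x_gt0 : 0 < v (x ^+ n) by rewrite lt_def x0 absv_ge0.
  apply: le_lt_trans (_ : e / 2 < _); last first.
    by rewrite ltr_pdivrMr // mulr_natr mulr2n ltrDl.
  rewrite -ler_pdivlMr //; apply: eval_le => [|j].
    by rewrite divr_ge0 ?divr_ge0 // ltW.
  rewrite ler_pdivlMr // iter_shiftE.
  have := NP (n + j)%N (leq_trans Nn (leq_addr _ _)).
  rewrite subr0 => /ltW; apply: le_trans.
  rewrite !absvM !absvX -mulrA ler_wpM2l ?absv_ge0 // mulrC exprD.
  by rewrite ler_pM ?exprn_ge0 ?absv_ge0 // lerXn2r ?nnegrE ?absv_ge0.
exists (Entire qP); apply/entireP => -[|n]; rewrite ecoefD.
  by rewrite zsubM0 ecoefC eval_shift /= /q /= addrC addrK.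
rewrite zsubMS ecoefC addr0 /= {1}/q eval_shift iter_shiftE addn0.
by rewrite addrK.
Qed.

(** No entire function is a nonzero multiple of [1 / (z - a)]: the coefficients
of the geometric series do not decay at [a]. *)
Lemma zsubM_const a Q c : zsub a * Q = entire_const c -> c = 0.
Proof.
move=> zQ.
have Q0 : - (a * Q 0%N) = c by rewrite -zsubM0 zQ.
have QS n : Q n = a * Q n.+1.
  by apply/eqP; rewrite -subr_eq0 -zsubMS zQ.
have QX n : Q 0%N = Q n * a ^+ n.
  elim: n => [|n ->]; first by rewrite mulr1.
  by rewrite (QS n) exprS; ring.
have Q00 : Q 0%N = 0.
  apply/eqP; rewrite -absv_eq0; apply: contrapT => /negP Qn0.
  have e0 : 0 < v (Q 0%N) by rewrite lt_def Qn0 absv_ge0.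
  have /entire_coefsP/(_ a)/na_cvgP/(_ _ e0)[N] := ecoefP Q.
  by move=> /(_ _ (leqnn N)); rewrite -QX subr0 ltxx.
by rewrite -Q0 Q00 mulr0 oppr0.
Qed.

Lemma entire_constD c d :
  entire_const (c + d) = entire_const c + entire_const d :> E.
Proof. by apply/entireP => -[|n]; rewrite ecoefD !ecoefC ?addr0. Qed.

Lemma entire_constN c : entire_const (- c) = - entire_const c :> E.
Proof. by apply/entireP => -[|n]; rewrite ecoefN !ecoefC ?oppr0. Qed.

Lemma entire_constM c d :
  entire_const (c * d) = entire_const c * entire_const d :> E.
Proof. by apply/entireP => -[|n]; rewrite ecoefCM !ecoefC ?mulr0. Qed.

Lemma entire_const0 : entire_const 0 = 0 :> E.
Proof. by []. Qed.

Lemma entire_const1 : entire_const 1 = 1 :> E.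
Proof. by []. Qed.

(** The remainder determines the value, so that algebraic identities between
remainders give the laws of evaluation. *)
Lemma evalE F a Q c : F = zsub a * Q + entire_const c -> eval F a = c.
Proof.
move=> FQ; have [Q' FQ'] := entire_remainder F a.
apply/eqP; rewrite -subr_eq0; apply/eqP; apply: (@zsubM_const a (Q - Q')).
rewrite entire_constD entire_constN mulrBr.
have -> : zsub a * Q = F - entire_const c by rewrite FQ addrK.
have -> : zsub a * Q' = F - entire_const (eval F a) by rewrite {1}FQ' addrK.
by ring.
Qed.

Lemma evalD F G a : eval (F + G) a = eval F a + eval G a.
Proof.
have [Q FQ] := entire_remainder F a; have [Q' GQ] := entire_remainder G a.
apply: (@evalE _ _ (Q + Q')).
by rewrite {1}FQ {1}GQ entire_constD mulrDr addrACA.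
Qed.

Lemma evalM F G a : eval (F * G) a = eval F a * eval G a.
Proof.
have [Q FQ] := entire_remainder F a; have [Q' GQ] := entire_remainder G a.
apply: (@evalE _ _ (Q * G + entire_const (eval F a) * Q')).
rewrite entire_constM mulrDr -addrA (mulrCA (zsub a) (entire_const _)).
by rewrite -mulrDr -GQ mulrA -mulrDl -FQ.
Qed.

Lemma evalC c a : eval (entire_const c) a = c.
Proof. by apply: (@evalE _ _ 0); rewrite mulr0 add0r. Qed.

Lemma evalX F n a : eval (F ^+ n) a = eval F a ^+ n.
Proof.
elim: n => [|n IH]; first by rewrite !expr0 -entire_const1 evalC.
by rewrite !exprS evalM IH.
Qed.

Lemma eval_zsub a b : eval (zsub a) b = b - a.
Proof.
apply: (@evalE _ _ 1); rewrite mulr1.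
apply/entireP => -[|[|n]]; rewrite ecoefD ecoefC /= !coefB !coefX !coefC.
- by rewrite /= !sub0r addKr.
- by rewrite addr0.
- by rewrite /= addr0.
Qed.

Lemma eval_eq0P F a : eval F a = 0 <-> exists Q, F = zsub a * Q.
Proof.
split=> [F0|[Q ->]]; last by rewrite evalM eval_zsub subrr mul0r.
have [Q FQ] := entire_remainder F a; exists Q.
by rewrite {1}FQ F0 entire_const0 addr0.
Qed.

Lemma dominant_zsub a r : 0 < r -> dominant (zsub a) r (v a <= r)%R.
Proof.
move=> r0; have c0 : zsub a 0%N = - a by rewrite /= coefB coefX coefC sub0r.
have c1 : zsub a 1%N = 1 by rewrite /= coefB coefX coefC subr0.
have cS n : zsub a n.+2 = 0 by rewrite /= coefB coefX coefC subr0.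
move: (zsub a) c0 c1 cS => z c0 c1 cS; rewrite /dominant.
case: leP => [ar|ra] /=.
  rewrite c1 absv1 mul1r expr1.
  split=> [|[|[|n]]|[|[|n]] //= _]; rewrite ?oner_neq0 ?c0 ?c1 ?cS //.
  - by rewrite absvN expr0 mulr1.
  - by rewrite absv1 mul1r.
  - by rewrite absv0 mul0r ltW.
  - by rewrite absv0 mul0r.
have a0 : 0 < v a by rewrite (lt_trans r0).
rewrite c0 absvN expr0 mulr1.
split=> [|[|[|n]]|[|[|n]] //= _]; rewrite ?c0 ?c1 ?cS.
- by rewrite oppr_eq0 -absv_gt0.
- by rewrite absvN mulr1.
- by rewrite absv1 mul1r ltW.
- by rewrite absv0 mul0r ltW.
- by rewrite absv1 mul1r.
- by rewrite absv0 mul0r.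
Qed.

Lemma gidx_zsub a r : 0 < r -> gidx (zsub a) r = (v a <= r)%R.
Proof. by move=> /dominant_zsub/gidxE. Qed.

Lemma gauss_zsub a r : 0 < r -> gauss (zsub a) r = Num.max r (v a).
Proof.
move=> r0; rewrite /gauss gidx_zsub //; case: leP => ar.
  by rewrite /= coefB coefX coefC subr0 absv1 mul1r.
by rewrite /= coefB coefX coefC sub0r absvN mulr1.
Qed.

Lemma eval_le_gauss F a r : 0 < r -> v a <= r -> v (eval F a) <= gauss F r.
Proof.
move=> r0 ar; apply: eval_le => [|n]; first exact: gauss_ge0.
apply: le_trans (coef_le_gauss F n r0).
by rewrite absvM absvX ler_wpM2l ?absv_ge0 // lerXn2r ?nnegrE ?absv_ge0 ?(ltW
  r0).
Qed.

End Evaluation.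

(** * Orders of vanishing *)

Section Order.
Variables (R : realType) (K : nonArchClosedFieldType R).
Local Notation v := (@absv R K).
Local Notation E := (entire K).
Implicit Types (F G H Q : E) (r s : R) (a x : K).

Definition is_ord a F n := exists2 G, F = zsub a ^+ n * G & eval G a != 0.

(** Each division by [z - a] lowers the dominant index of a disc containing [a],
so that the process stops. *)
Lemma is_ord_exists a F : F != 0 -> exists n, is_ord a F n.
Proof.
pose r := Num.max 1 (v a); have r0 : 0 < r by rewrite lt_max ltr01.
have ar : v a <= r by rewrite le_max lexx orbT.
move: {2}(gidx F r) (erefl (gidx F r)) => k; elim: k F => [|k IH] F Fk F0.
  exists 0%N; exists F; rewrite ?mul1r //; apply/eqP => /eval_eq0P[Q FQ].
  move: F0 Fk; rewrite FQ mulf_eq0 negb_or => /andP[z0 Q0].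
  by rewrite gidxM // gidx_zsub // ar.
have [/eval_eq0P[Q FQ]|Fa] := eqVneq (eval F a) 0; last first.
  by exists 0%N; exists F; rewrite ?mul1r.
move: F0 Fk; rewrite FQ mulf_eq0 negb_or => /andP[z0 Q0].
rewrite gidxM // gidx_zsub // ar add1n => -[/IH/(_ Q0)[n [G QG Ga]]].
by exists n.+1, G; rewrite // QG exprS mulrA.
Qed.

Lemma is_ord_unique a F m n : is_ord a F m -> is_ord a F n -> m = n.
Proof.
wlog mn : m n / (m <= n)%N => [hw|[G -> Ga] [H + Ha]].
  by case: (leqP m n) => [|/ltnW] /hw + Fm Fn => [/(_ Fm Fn)|/(_ Fn Fm)].
rewrite -{1}(subnK mn) addnC exprD -mulrA => /mulfI.
rewrite expf_eq0 (negPf (zsub_neq0 a)) andbF => /(_ isT) GH.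
apply/eqP; rewrite eqn_leq mn /= -subn_eq0; apply: contraT => nm.
by move: Ga; rewrite GH evalM evalX eval_zsub subrr expr0n (negPf nm) mul0r
  eqxx.
Qed.

(** Only meaningful for a nonzero function; the zero function gets order [0]. *)
Definition ord a F : nat := xget 0%N [set n | is_ord a F n]%classic.

Lemma ordE a F n : is_ord a F n -> ord a F = n.
Proof. by move=> Fn; apply: xget_unique => // m /is_ord_unique; apply. Qed.

Lemma ordP a F : F != 0 -> is_ord a F (ord a F).
Proof. by move=> F0; apply: xgetPex; exact: is_ord_exists. Qed.

Lemma ordM a F G : F != 0 -> G != 0 -> ord a (F * G) = (ord a F + ord a G)%N.
Proof.
move=> /(ordP a)[F1 F_ F1a] /(ordP a)[G1 G_ G1a]; apply: ordE.
exists (F1 * G1); first by rewrite {1}F_ {1}G_ exprD mulrACA.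
by rewrite evalM mulf_neq0.
Qed.

Lemma ordX a F n : F != 0 -> ord a (F ^+ n) = (n * ord a F)%N.
Proof.
move=> F0; elim: n => [|n IH]; last by rewrite exprS ordM ?expf_neq0 // IH.
apply: ordE; exists 1; rewrite ?mulr1 //.
by rewrite -entire_const1 evalC oner_neq0.
Qed.

Lemma ord_zsub a b : ord b (zsub a) = (a == b).
Proof.
apply: ordE; have [->|ab] := eqVneq a b.
  by exists 1; rewrite ?mulr1 // -entire_const1 evalC oner_neq0.
by exists (zsub a); rewrite ?mul1r // eval_zsub subr_eq0 eq_sym.
Qed.

Lemma ord_const a c : c != 0 -> ord a (entire_const c) = 0%N.
Proof.
by move=> c0; apply: ordE; exists (entire_const c); rewrite ?mul1r ?evalC.
Qed.

Lemma ord_gt0 a F : F != 0 -> (0 < ord a F)%N = (eval F a == 0).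
Proof.
move=> F0; have [G FG Ga] := ordP a F0; rewrite {2}FG evalM evalX eval_zsub.
rewrite subrr mulf_eq0 (negPf Ga) orbF expr0n; case: (ord a F) => [|n] //=.
  by rewrite oner_eq0.
by rewrite eqxx.
Qed.

Lemma ord_geP a F n : F != 0 ->
  (n <= ord a F)%N <-> exists Q, F = zsub a ^+ n * Q.
Proof.
move=> F0; split=> [nF|[Q FQ]].
  have [G FG _] := ordP a F0; exists (zsub a ^+ (ord a F - n) * G).
  by rewrite mulrA -exprD subnKC.
have Q0 : Q != 0 by apply: contraNneq F0 => Q0; rewrite FQ Q0 mulr0.
by rewrite FQ ordM ?expf_neq0 ?zsub_neq0 // ordX ?zsub_neq0 // ord_zsub
  eqxx muln1 leq_addr.
Qed.

End Order.

(** * Zeros in a disc and growth of quotients without poles *)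

Section Zeros.
Variables (R : realType) (K : nonArchClosedFieldType R).
Local Notation v := (@absv R K).
Local Notation E := (entire K).
Implicit Types (F G H Q : E) (r s : R) (a x : K) (p : {poly K}).

Lemma eval_poly p a : eval (entire_poly p) a = p.[a].
Proof.
apply: na_cvg_unique (evalP _ _) _; apply/na_cvgP => e e0.
exists (size p) => n pn; rewrite /series /= (big_cat_nat _ pn) //=.
rewrite [X in _ + X - _]big_nat_cond [X in _ + X - _]big1 => [|i /andP[/andP[pi
  _] _]].
  by rewrite addr0 big_mkord -horner_coef subrr absv0.
by rewrite nth_default // mul0r.
Qed.

(** The factors of a split polynomial at [b] are compared with the Gauss norms
of its linear factors: a root outside the disc contributes the same to both, a
root inside contributes at least [e] to the value and [r] to the norm. *)
Lemma prod_roots_ge (l : seq K) r b (e : R) : 0 < r -> 0 <= e -> v b <= r ->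
    (forall z, z \in l -> v z <= r -> e <= v (b - z)) ->
  let k := count (fun z => v z <= r) l in
  \prod_(z <- l) gauss (zsub z) r * e ^+ k <=
  r ^+ k * \prod_(z <- l) v (b - z).
Proof.
move=> r0 e0 br /=; elim: l => [|z l IH] le_e.
  by rewrite !big_nil /= !expr0 !mulr1.
have {IH} := IH (fun y yl => le_e y (mem_behead (s := z :: l) yl)).
rewrite !big_cons gauss_zsub //=; set A := \prod_(_ <- _) _.
set B := \prod_(_ <- _) _; set k := count _ _ => IH.
have A0 : 0 <= A by apply: prodr_ge0 => i _; exact: gauss_ge0.
have e_z := le_e z (mem_head _ _).
have [zr|rz] := leP (v z) r.
  rewrite add1n !exprS.
  have -> : r * A * (e * e ^+ k) = e * r * (A * e ^+ k) by ring.
  have -> : r * r ^+ k * (v (b - z) * B) = (v (b - z) * r) * (r ^+ k * B).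
    by ring.
  rewrite ler_pM // ?mulr_ge0 ?exprn_ge0 ?(ltW r0) //.
  by rewrite ler_pM2r // e_z.
have -> : v (b - z) = v z.
  by rewrite -absvN opprB absvD_dominant // absvN (le_lt_trans br).
have -> : r ^+ k * (v z * B) = v z * (r ^+ k * B) by ring.
by rewrite add0n -mulrA ler_wpM2l ?absv_ge0.
Qed.

Lemma gauss_prod (l : seq K) r : 0 < r ->
  gauss (\prod_(z <- l) zsub z) r = \prod_(z <- l) gauss (zsub z) r.
Proof.
move=> r0; apply: (big_morph (fun F => gauss F r)) => [F G|].
  exact: gaussM.
by rewrite -entire_const1 gaussC // absv1.
Qed.

Lemma gidx_prod (l : seq K) r : 0 < r ->
  gidx (\prod_(z <- l) zsub z) r = count (fun z => v z <= r) l.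
Proof.
move=> r0; elim: l => [|z l IH].
  rewrite big_nil /=; apply: gidxE; split=> [|n|[|n] //= _].
  - exact: oner_neq0.
  - by case: n => [|n] //=; rewrite absv0 mul0r absv1 mul1r.
  - by rewrite absv0 mul0r absv1 mul1r.
rewrite big_cons gidxM ?zsub_neq0 //= ?IH ?gidx_zsub //.
by rewrite prodf_seq_neq0; apply/allP => y _; exact: zsub_neq0.
Qed.

Lemma entire_polyZ c p : entire_poly (c *: p) = entire_const c * entire_poly p.
Proof. by apply/entireP => n; rewrite ecoefCM /= coefZ. Qed.

Lemma entire_poly_prod (l : seq K) :
  entire_poly (\prod_(z <- l) ('X - z%:P)) = \prod_(z <- l) zsub z.
Proof.
elim: l => [|z l IH]; first by rewrite !big_nil entire_polyC.
by rewrite !big_cons entire_polyM IH.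
Qed.

(** The distance from [b] to the nearest root in the disc serves as [e] in
[prod_roots_ge].  The bound involves the number of roots in the disc only, and
not the degree of [p]. *)
Lemma near_root p r b : 0 < r -> v b <= r -> p != 0 ->
    let P := entire_poly p in (0 < gidx P r)%N ->
  exists y, [/\ root p y, v y <= r &
    gauss P r * v (b - y) ^+ gidx P r <= r ^+ gidx P r * v p.[b]].
Proof.
move=> r0 br p0 /=; have [l pE] := closed_field_poly_normal p.
have c0 : lead_coef p != 0 by rewrite lead_coef_eq0.
have PE : entire_poly p = entire_const (lead_coef p) * \prod_(z <- l) zsub z.
  by rewrite {1}pE entire_polyZ entire_poly_prod.
have pr0 : \prod_(z <- l) zsub z != 0 :> E.
  by rewrite prodf_seq_neq0; apply/allP => y _; exact: zsub_neq0.
have cE0 : entire_const (lead_coef p) != 0 :> E.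
  apply: contraNneq c0 => /(congr1 (fun F : E => F 0%N)).
  by rewrite ecoefC ecoef0 => ->.
have gidxC : gidx (entire_const (lead_coef p)) r = 0%N.
  apply: gidxE; split=> [|n|[|n] //= _] //.
  - by case: n => [|n] //=; rewrite absv0 mul0r mulr1 absv_ge0.
  - by rewrite absv0 mul0r mulr1 absv_gt0.
have kE : gidx (entire_poly p) r = count (fun z => v z <= r) l.
  by rewrite PE gidxM // gidxC gidx_prod.
have gE : gauss (entire_poly p) r =
    v (lead_coef p) * \prod_(z <- l) gauss (zsub z) r.
  by rewrite PE gaussM // gaussC // gauss_prod.
have bE : v p.[b] = v (lead_coef p) * \prod_(z <- l) v (b - z).
  rewrite {1}pE hornerZ absvM horner_prod; congr (_ * _).
  rewrite (big_morph v (@absvM R K) (absv1 K)).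
  by apply: eq_bigr => z _; rewrite hornerXsubC.
rewrite kE -has_count => /hasP[z0 z0l z0r].
have i0 : (index z0 l < size l)%N by rewrite index_mem.
have i0r : v (nth 0 l (Ordinal i0)) <= r by rewrite nth_index.
have [i ir imin] := @Order.TotalTheory.arg_minP _ R _ (Ordinal i0)
  (fun i : 'I_(size l) => v (nth 0 l i) <= r)
  (fun i => v (b - nth 0 l i)) i0r.
exists (nth 0 l i); split=> //.
  rewrite pE rootZ // root_prod_XsubC.
  exact: mem_nth.
rewrite gE bE -mulrA mulrCA [X in _ <= X]mulrCA.
rewrite mulrCA ler_wpM2l ?absv_ge0 //.
apply: prod_roots_ge => //; first exact: absv_ge0.
move=> z zl zr; have zi : (index z l < size l)%N by rewrite index_mem.
by have := imin (Ordinal zi); rewrite /= nth_index //; apply.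
Qed.

Definition truncation F n : {poly K} := \poly_(i < n.+1) F i.

Lemma dominant_truncation F r n : 0 < r -> dominant F r (gidx F r) ->
  (gidx F r <= n)%N -> dominant (entire_poly (truncation F n)) r (gidx F r).
Proof.
move=> r0 [Fk Fle Flt] kn; have tE i : entire_poly (truncation F n) i =
    if (i <= n)%N then F i else 0 by rewrite /= coef_poly ltnS.
split=> [|i|i ki]; rewrite !tE kn //.
  case: ifP => // _; rewrite absv0 mul0r; apply: le_trans (Fle i).
  by rewrite mulr_ge0 ?absv_ge0 // exprn_ge0 // ltW.
case: ifP => _; first exact: Flt.
rewrite absv0 mul0r; apply: le_lt_trans (Flt _ ki).
by rewrite mulr_ge0 ?absv_ge0 // exprn_ge0 // ltW.
Qed.

Lemma truncationS F n a :
  (truncation F n.+1).[a] = (truncation F n).[a] + F n.+1 * a ^+ n.+1.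
Proof. by rewrite !horner_poly big_ord_recr. Qed.

Lemma truncation_dist F r n a b : 0 < r -> v a <= r -> v b <= r ->
  root (truncation F n) a ->
  r * v (truncation F n).[b] <= gauss (entire_poly (truncation F n)) r * v (b -
    a).
Proof.
move=> r0 ar br /factor_theorem[q ->]; rewrite entire_polyM gaussM //.
rewrite [gauss (entire_poly ('X - _)) _]gauss_zsub // (max_l ar) hornerM.
rewrite hornerXsubC absvM mulrA ler_wpM2r ?absv_ge0 // mulrC.
by rewrite ler_pM2r // -eval_poly eval_le_gauss.
Qed.

(** The truncations of [F] have as many roots in the disc as the dominant index
of [F], and [near_root] makes it possible to choose them so that they form a
Cauchy sequence; [F] vanishes at its limit. *)
Lemma zero_exists F r : 0 < r -> F != 0 -> (0 < gidx F r)%N ->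
  exists2 a, v a <= r & eval F a = 0.
Proof.
move=> r0 F0; have domF := gidxP r0 F0; set k := gidx F r in domF * => k0.
pose p n := truncation F (k + n); pose P n := entire_poly (p n).
have domP n : dominant (P n) r k.
  by apply: dominant_truncation r0 domF _; exact: leq_addr.
have gidxPn n : gidx (P n) r = k by exact: gidxE.
set M := gauss F r.
have M0 : 0 < M by exact: gauss_gt0.
have gaussP n : gauss (P n) r = M.
  by rewrite /gauss gidxPn /P /= coef_poly ltnS leq_addr.
have p0 n : p n != 0.
  apply/eqP => pn0; have [+ _ _] := domP n.
  by rewrite /P pn0 /= coef0 eqxx.
have near n b : v b <= r -> exists y, [/\ root (p n) y, v y <= r &
    M * v (b - y) ^+ k <= r ^+ k * v (p n).[b]].
  move=> br; have := near_root r0 br (p0 n); rewrite /= -/(P n) gidxPn gaussP.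
  exact.
have step (nb : nat * K) : exists y, v nb.2 <= r ->
    [/\ root (p nb.1) y, v y <= r &
        M * v (nb.2 - y) ^+ k <= r ^+ k * v (p nb.1).[nb.2]].
  have [br|nbr] := pselect (v nb.2 <= r); last by exists 0.
  by have [y yP] := near nb.1 nb.2 br; exists y.
have [g gP] := choice step.
pose a := fix a n : K := if n is m.+1 then g (n, a m) else g (0%N, 0).
have aS n : a n.+1 = g (n.+1, a n) by [].
have aP n : root (p n) (a n) /\ v (a n) <= r.
  elim: n => [|n [_ ar]].
    by have [] := gP (0%N, 0); rewrite /= ?absv0 ?(ltW r0).
  by have [] := gP (n.+1, a n) ar; rewrite -aS.
have a_step n : M * v (a n - a n.+1) ^+ k <=
    r ^+ k * (v (F (k + n).+1) * r ^+ (k + n).+1).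
  have [pan ar] := aP n; have [_ _] := gP (n.+1, a n) ar; rewrite -aS /=.
  move/le_trans; apply; rewrite ler_wpM2l ?exprn_ge0 ?(ltW r0) //.
  rewrite /p addnS truncationS (rootP pan) add0r absvM absvX.
  by rewrite ler_wpM2l ?absv_ge0 // lerXn2r ?nnegrE ?absv_ge0 ?(ltW r0).
have a_small (e : R) : 0 < e ->
    exists N, forall n, (N <= n)%N -> v (a n - a n.+1) < e.
  move=> e0; have d0 : 0 < M * (e / r) ^+ k.
    by rewrite mulr_gt0 // exprn_gt0 // divr_gt0.
  have [N NP] := gauss_terms_cvg0 F r0 d0; exists N => n Nn.
  rewrite -(@ltr_pXn2r _ k) ?nnegrE ?absv_ge0 ?(ltW e0) //.
  rewrite -(ltr_pM2l M0); apply: le_lt_trans (a_step n) _.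
  apply: lt_le_trans (_ : r ^+ k * (M * (e / r) ^+ k) <= _).
    rewrite ltr_pM2l ?exprn_gt0 // NP //.
    exact: leq_trans Nn (leq_trans (leq_addl k n) (leqnSn _)).
  by rewrite mulrCA -exprMn mulrCA divff ?mulr1 // gt_eqF.
have a_near (e : R) : 0 < e ->
    exists N, forall n, (N <= n)%N -> v (a n - a N) < e.
  move=> e0; have [N NP] := a_small e e0; exists N => n Nn.
  rewrite -(subnK Nn); elim: (n - N)%N => [|m IH].
    by rewrite add0n subrr absv0.
  rewrite addSn -[a _.+1](subrK (a (m + N)%N)) -addrA.
  rewrite (le_lt_trans (absv_leD_max _ _)) // gt_max IH andbT.
  by rewrite -absvN opprB NP // leq_addl.
have [b ab] : exists b, na_cvg a b.
  apply: absv_complete => e e0; have [N NP] := a_near e e0;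
    exists N => m n Nm Nn.
  rewrite -[a m](subrK (a N)) -addrA.
  rewrite (le_lt_trans (absv_leD_max _ _)) // gt_max NP //=.
  by rewrite -absvN opprB NP.
have br : v b <= r.
  have /na_cvgP/(_ r r0)[N /(_ N (leqnn N)) NP] := ab.
  rewrite -[b](subrK (a N)) (le_trans (absv_leD_max _ _)) // ge_max.
  by rewrite -absvN opprB (ltW NP) (aP N).2.
exists b => //; apply/eqP; rewrite -absv_eq0; apply: contraT => Fb.
have Fb0 : 0 < v (eval F b) by rewrite lt_def Fb absv_ge0.
have /na_cvgP/(_ _ Fb0)[N NP] := evalP F b.
have d0 : 0 < r * v (eval F b) / M by rewrite divr_gt0 // mulr_gt0.
have /na_cvgP/(_ _ d0)[N' NP'] := ab.
pose n := maxn N N'.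
have pE : (p n).[b] = series (fun i => F i * b ^+ i) (k + n).+1.
  by rewrite horner_poly /series /= big_mkord.
have close : v ((p n).[b] - eval F b) < v (eval F b).
  rewrite pE NP //; apply: leq_trans (leqW (leq_addl k n)).
  exact: leq_maxl.
have pFb : v (p n).[b] = v (eval F b).
  by rewrite -(absvD_dominant close) addrC subrK.
have [pan ar] := aP n.
have := truncation_dist r0 ar br pan; rewrite -/(p n) -/(P n) gaussP pFb.
rewrite leNgt -absvN opprB mulrC -ltr_pdivlMr // => /negP; case.
by apply: NP'; exact: leq_maxr.
Qed.

(** When the common zeros have been divided out one at a time, the denominator
has no zero in the disc, hence constant norm, while the norm of the numerator
does not decrease. *)
Lemma gauss_quotient_homo F G r s : 0 < s -> s <= r -> F != 0 -> G != 0 ->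
    (forall a, ord a G <= ord a F)%N ->
  gauss F s * gauss G r <= gauss F r * gauss G s.
Proof.
move=> s0 sr; have r0 := lt_le_trans s0 sr.
move: {2}(gidx G r) (erefl (gidx G r)) => k.
elim: k F G => [|k IH] F G Gk F0 G0 FG.
  rewrite (gauss_gidx0 s0 sr Gk) ler_wpM2r ?gauss_ge0 //.
  exact: gauss_homo.
have [|a ar Ga] := @zero_exists G r r0 G0; first by rewrite Gk.
have ordG : (0 < ord a G)%N by rewrite ord_gt0 // Ga.
have [F1 FE] : exists Q, F = zsub a * Q.
  by apply/eval_eq0P/eqP; rewrite -ord_gt0 // (leq_trans ordG).
have [G1 GE] := (eval_eq0P _ _).1 Ga.
have F10 : F1 != 0 by apply: contraNneq F0 => F10; rewrite FE F10 mulr0.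
have G10 : G1 != 0 by apply: contraNneq G0 => G10; rewrite GE G10 mulr0.
have z0 := zsub_neq0 a.
move: Gk FG; rewrite FE GE gidxM // gidx_zsub // ar add1n.
move=> -[G1k] FG; rewrite !gaussM // mulrACA [X in _ <= X]mulrACA.
rewrite [X in _ <= X * _]mulrC ler_wpM2l //.
  by apply: mulr_ge0; exact: gauss_ge0.
apply: IH => // b; have := FG b; rewrite !ordM //.
by rewrite leq_add2l.
Qed.

(** The norm of [F / G] is nondecreasing in the radius, yet at most [C / r]. *)
Lemma entire_quotient_eq0 F G (C : R) : G != 0 ->
    (F != 0 -> forall a, (ord a G <= ord a F)%N) ->
    (forall r, 1 <= r -> r * gauss F r <= C * gauss G r) ->
  F = 0.
Proof.
move=> G0 FG bnd; apply/eqP; apply: contraT => F0.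
have g1 H : H != 0 -> 0 < gauss H 1 by exact: gauss_gt0.
pose r := Num.max 1 (C * gauss G 1 / gauss F 1 + 1).
have r1 : 1 <= r by rewrite le_max lexx.
have r0 : 0 < r by rewrite (lt_le_trans ltr01).
have := gauss_quotient_homo ltr01 r1 F0 G0 (FG F0).
move=> h; have {}h : r * gauss F 1 * gauss G r <= C * gauss G 1 * gauss G r.
  have br := bnd r r1.
  have : r * (gauss F 1 * gauss G r) <= r * (gauss F r * gauss G 1).
    by rewrite ler_pM2l.
  move/le_trans: (ler_wpM2r (ltW (g1 G G0)) br) => le.
  rewrite -mulrA => /le_trans; apply; rewrite mulrA; apply: le.
  by rewrite mulrAC.
have {}h : r * gauss F 1 <= C * gauss G 1.
  by rewrite -(ler_pM2r (gauss_gt0 r0 G0)).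
have : C * gauss G 1 / gauss F 1 + 1 <= r by rewrite le_max lexx orbT.
by rewrite -ler_pdivlMr ?g1 // in h; lra.
Qed.

End Zeros.

(** * Wronskians and forms over the projective line *)

Section Wronskian.
Variables (R : realType) (K : nonArchClosedFieldType R).
Local Notation v := (@absv R K).
Local Notation E := (entire K).
Local Notation kc := (@entire_const R K).
Implicit Types (F G H Q L : E) (r s : R) (a x c : K) (e : option K).

Lemma entire_const_neq0 c : c != 0 -> kc c != 0.
Proof.
apply: contraNneq => /(congr1 (fun F : E => F 0%N)).
by rewrite ecoefC ecoef0 => ->.
Qed.

(** The fibre of [F / G] over the point [e] of the projective line; [None]
stands for infinity. *)
Definition lform F G e : E := if e is Some c then F - kc c * G else G.

Definition wronskian F G : E := entire_deriv F * G - F * entire_deriv G.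

Lemma entire_derivB F G :
  entire_deriv (F - G) = entire_deriv F - entire_deriv G.
Proof. by apply/entireP => n; rewrite ecoefB !ecoef_deriv mulrBr. Qed.

(** The wronskian is bilinear and alternating, so a change of basis multiplies
it by a determinant. *)
Lemma wronskian_lform e e' : e != e' -> exists2 c, c != 0 & forall F G,
  wronskian (lform F G e) (lform F G e') = kc c * wronskian F G.
Proof.
have id1 (T : comNzRingType) (f g f' g' c d : T) :
    (f' - c * g') * (f - d * g) - (f - c * g) * (f' - d * g') =
    (c - d) * (f' * g - f * g') by ring.
have id2 (T : comNzRingType) (f g f' g' c : T) :
    (f' - c * g') * g - (f - c * g) * g' = 1 * (f' * g - f * g') by ring.
have id3 (T : comNzRingType) (f g f' g' c : T) :
    g' * (f - c * g) - g * (f' - c * g') = - 1 * (f' * g - f * g') by ring.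
case: e e' => [c|] [d|] //= cd.
- exists (c - d) => [|F G]; first by rewrite subr_eq0;
  apply: contraNneq cd => ->.
  rewrite /wronskian !(entire_derivB, entire_derivCM).
  by rewrite entire_constD entire_constN id1.
- exists 1 => [|F G]; first exact: oner_neq0.
  by rewrite /wronskian !(entire_derivB, entire_derivCM) id2.
- exists (- 1) => [|F G]; first by rewrite oppr_eq0 oner_neq0.
  rewrite /wronskian !(entire_derivB, entire_derivCM).
  by rewrite entire_constN id3.
Qed.

Lemma lform_span e e' : e != e' -> exists A : K * K * K * K, forall F G,
  G = kc A.1.1.1 * lform F G e + kc A.1.1.2 * lform F G e' /\
  F = kc A.1.2 * lform F G e + kc A.2 * lform F G e'.
Proof.
have id1 (T : comNzRingType) (f g c d i : T) : i * (c - d) = 1 ->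
    g = - i * (f - c * g) + i * (f - d * g) /\
    f = (- i * d) * (f - c * g) + (i * c) * (f - d * g).
  by move=> icd; split; rewrite -[LHS]mul1r -icd; ring.
have id2 (T : comNzRingType) (f g c : T) :
  g = 0 * (f - c * g) + 1 * g /\ f = 1 * (f - c * g) + c * g by split; ring.
have id3 (T : comNzRingType) (f g c : T) :
  g = 1 * g + 0 * (f - c * g) /\ f = c * g + 1 * (f - c * g) by split; ring.
case: e e' => [c|] [d|] //= cd.
- have cd0 : c - d != 0 by rewrite subr_eq0; apply: contraNneq cd => ->.
  pose i := (c - d)^-1; exists (- i, i, - i * d, i * c) => F G /=.
  rewrite !entire_constM entire_constN; apply: id1.
  by rewrite -entire_constN -entire_constD -entire_constM mulVf.
- by exists (0, 1, 1, c) => F G /=; apply: id2.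
- by exists (1, 0, d, 1) => F G /=; apply: id3.
Qed.

Lemma gauss_wronskian F G r : 0 < r ->
  r * gauss (wronskian F G) r <= gauss F r * gauss G r.
Proof.
move=> r0; rewrite -ler_pdivlMl // (le_trans (gaussB _ _ r0)) // ge_max.
rewrite !gaussM // !ler_pdivlMl //; apply/andP; split.
  by rewrite mulrA mulrC [r * _]mulrC mulrC ler_wpM2r ?gauss_ge0 // gauss_deriv.
by rewrite mulrCA ler_wpM2l ?gauss_ge0 // mulrC gauss_deriv.
Qed.

Lemma gauss_lform_max e e' : e != e' -> exists2 C : R, 0 <= C &
  forall F G r, 0 < r -> Num.max (gauss F r) (gauss G r) <=
    C * Num.max (gauss (lform F G e) r) (gauss (lform F G e') r).
Proof.
move=> /lform_span[A AP]; pose m (x y : R) := Num.max x y.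
pose C := m (m (v A.1.1.1) (v A.1.1.2)) (m (v A.1.2) (v A.2)).
have C0 : 0 <= C by rewrite !le_max absv_ge0.
exists C => // F G r r0; set L := lform F G e; set L' := lform F G e'.
have bnd (x y : K) : v x <= C -> v y <= C ->
    gauss (kc x * L + kc y * L') r <= C * m (gauss L r) (gauss L' r).
  move=> xC yC; rewrite (le_trans (gaussD _ _ r0)) // ge_max.
  rewrite !gaussM // !gaussC //.
  by apply/andP; split; rewrite ler_pM ?absv_ge0 ?gauss_ge0 // le_max lexx
    ?orbT.
have [GE FE] := AP F G.
have [c1 c2 c3 c4] : [/\ v A.1.1.1 <= C, v A.1.1.2 <= C, v A.1.2 <= C & v A.2
  <= C].
  by split; rewrite /C /m !le_max lexx ?orbT.
have gF := bnd _ _ c3 c4; have gG := bnd _ _ c1 c2.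
by rewrite -FE in gF; rewrite -GE in gG; rewrite ge_max gF gG.
Qed.

(** At most one of the four forms is small against [F] and [G], and the
wronskian is bounded by the product of that form with any other. *)
Lemma gauss_wronskian_four e1 e2 e3 e4 : e1 != e2 -> e3 != e4 ->
    e1 != e3 -> e1 != e4 -> e2 != e3 -> e2 != e4 ->
  exists2 C : R, 0 <= C & forall F G r, 0 < r ->
    r * gauss (wronskian F G) r * Num.max (gauss F r) (gauss G r) ^+ 2 <=
    C * ((gauss (lform F G e1) r * gauss (lform F G e2) r) *
         (gauss (lform F G e3) r * gauss (lform F G e4) r)).
Proof.
move=> e12 e34 e13 e14 e23 e24.
have W e e' : e != e' -> exists2 B : R, 0 <= B & forall F G r, 0 < r ->
    r * gauss (wronskian F G) r <=
    B * (gauss (lform F G e) r * gauss (lform F G e') r).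
  move=> /wronskian_lform[c c0 WE]; exists (v c)^-1 => [|F G r r0].
    by rewrite invr_ge0 absv_ge0.
  rewrite ler_pdivlMl ?absv_gt0 // mulrCA -(gaussC c r0) -(gaussM (kc c)) //
    -WE.
  exact: gauss_wronskian.
have [C C0 CP] := gauss_lform_max e12; have [D D0 DP] := gauss_lform_max e34.
have [B13 B130 B13P] := W _ _ e13; have [B14 B140 B14P] := W _ _ e14.
have [B23 B230 B23P] := W _ _ e23; have [B24 B240 B24P] := W _ _ e24.
pose B := B13 + B14 + B23 + B24.
have [B0 B13B B14B B23B B24B] :
    [/\ 0 <= B, B13 <= B, B14 <= B, B23 <= B & B24 <= B].
  by split; rewrite /B; lra.
exists (C * D * B) => [|F G r r0]; first by rewrite !mulr_ge0.
move: (CP F G r r0) (DP F G r r0) (B13P F G r r0) (B14P F G r r0).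
move: (B23P F G r r0) (B24P F G r r0).
set w := r * _; set l1 := gauss (lform F G e1) r.
set l2 := gauss (lform F G e2) r; set l3 := gauss (lform F G e3) r.
set l4 := gauss (lform F G e4) r; set s := Num.max (gauss F r) (gauss G r).
have [p1 p2 p3 p4] : [/\ 0 <= l1, 0 <= l2, 0 <= l3 & 0 <= l4].
  by split; exact: gauss_ge0.
have s0 : 0 <= s by rewrite /s le_max gauss_ge0.
have w0 : 0 <= w by rewrite mulr_ge0 ?gauss_ge0 ?(ltW r0).
(* [x] and [z] are the larger forms of the two pairs. *)
have main (x y z t b : R) : 0 <= x -> 0 <= y -> 0 <= z -> 0 <= t -> b <= B ->
    s <= C * x -> s <= D * z -> w <= b * (y * t) ->
    w * s ^+ 2 <= C * D * B * ((x * y) * (z * t)).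
  move=> x0 y0 z0 t0 bB sx sz wyt.
  have -> : C * D * B * (x * y * (z * t)) =
    (B * (y * t)) * ((C * x) * (D * z)) by ring.
  rewrite expr2; apply: ler_pM => //; first by rewrite mulr_ge0.
    by apply: le_trans wyt _; rewrite ler_wpM2r // mulr_ge0.
  exact: ler_pM.
move=> w23 w24 + + w13 w14.
case: (leP l1 l2) => _ sC; case: (leP l3 l4) => _ sD.
- rewrite (mulrC l1) (mulrC l3); exact: (main _ _ _ _ B13).
- rewrite (mulrC l1); exact: (main _ _ _ _ B14).
- rewrite (mulrC l3); exact: (main _ _ _ _ B23).
- exact: (main _ _ _ _ B24).
Qed.

End Wronskian.

(** * Local behaviour of a quotient of entire functions *)

Section LocalOrders.
Variables (R : realType) (K : nonArchClosedFieldType R).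
Local Notation E := (entire K).
Local Notation kc := (@entire_const R K).
Implicit Types (F G H Q L : E) (a c : K) (e : option K).

Definition zdvd a n F := exists Q, F = zsub a ^+ n * Q.

Lemma zdvdW a m n F : (m <= n)%N -> zdvd a n F -> zdvd a m F.
Proof.
move=> mn [Q ->]; exists (zsub a ^+ (n - m) * Q).
by rewrite mulrA -exprD subnKC.
Qed.

Lemma zdvdB a n F G : zdvd a n F -> zdvd a n G -> zdvd a n (F - G).
Proof. by move=> [Q ->] [Q' ->]; exists (Q - Q'); rewrite mulrBr. Qed.

Lemma zdvdM a m n F G : zdvd a m F -> zdvd a n G -> zdvd a (m + n) (F * G).
Proof. by move=> [Q ->] [Q' ->]; exists (Q * Q'); rewrite mulrACA exprD. Qed.

Lemma zdvd_ord a F : F != 0 -> zdvd a (ord a F) F.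
Proof. by move=> F0; apply/ord_geP. Qed.

Lemma zdvd_deriv a n F : zdvd a n F -> zdvd a n.-1 (entire_deriv F).
Proof.
case: n => [|n] [Q ->]; first by exists (entire_deriv (zsub a ^+ 0 * Q));
  rewrite [RHS]mul1r.
elim: n Q => [|n IH] Q; first by exists (entire_deriv (zsub a ^+ 1 * Q));
  rewrite [RHS]mul1r.
rewrite exprS -mulrA entire_derivM; have [Q' ->] := IH Q.
exists (entire_deriv (zsub a) * Q + Q').
by rewrite /= mulrDr [in RHS]mulrCA mulrCA !mulrA -exprS.
Qed.

Lemma ord_wronskian a F G : F != 0 -> G != 0 -> wronskian F G != 0 ->
  (ord a F + ord a G <= (ord a (wronskian F G)).+1)%N.
Proof.
move=> F0 G0 W0; set m := ord a F; set n := ord a G.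
have zF : zdvd a m F by exact: zdvd_ord.
have zG : zdvd a n G by exact: zdvd_ord.
suff : ((m + n).-1 <= ord a (wronskian F G))%N by lia.
apply/ord_geP => //; apply: zdvdB.
  apply: zdvdW (zdvdM (zdvd_deriv zF) zG); lia.
apply: zdvdW (zdvdM zF (zdvd_deriv zG)); lia.
Qed.

(** In the usual terms, [s] is the order of the common factor, [e]
the value of [F / G] at [a], and [k] the multiplicity with which it is taken. *)
Definition local_position a F G s k e := (0 < k)%N /\
  forall e', ord a (lform F G e') = (s + (e' == e) * k)%N.

Lemma local_positionP a F G : (forall e, lform F G e != 0) ->
  exists s k e, local_position a F G s k e.
Proof.
move=> FG0; have F0 : F != 0 by have := FG0 (Some 0); rewrite /= mul0r subr0.
have G0 : G != 0 by exact: FG0 None.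
pose s := minn (ord a F) (ord a G).
have [F1 FE] : zdvd a s F by apply: zdvdW (zdvd_ord a F0); exact: geq_minl.
have [G1 GE] : zdvd a s G by apply: zdvdW (zdvd_ord a G0); exact: geq_minr.
have lE e : lform F G e = zsub a ^+ s * lform F1 G1 e.
  by case: e => [c|] //=; rewrite {1}FE {1}GE mulrBr mulrCA.
have l0 e : lform F1 G1 e != 0.
  by apply: contraNneq (FG0 e) => l0; rewrite lE l0 mulr0.
have F10 : F1 != 0 by have := l0 (Some 0); rewrite /= mul0r subr0.
have G10 : G1 != 0 by exact: l0 None.
have zs0 : zsub a ^+ s != 0 by rewrite expf_neq0 ?zsub_neq0.
have ordzs : ord a (zsub a ^+ s) = s.
  by rewrite ordX ?zsub_neq0 // ord_zsub eqxx muln1.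
have ordl e : ord a (lform F G e) = (s + ord a (lform F1 G1 e))%N.
  by rewrite lE ordM // ordzs.
have unit : (eval F1 a != 0) || (eval G1 a != 0).
  rewrite -negb_and -!ord_gt0 //; apply/negP => /andP[F1a G1a].
  have sF : (s < ord a F)%N by rewrite FE ordM // ordzs -[X in (X < _)%N]addn0
    ltn_add2l.
  have sG : (s < ord a G)%N by rewrite GE ordM // ordzs -[X in (X < _)%N]addn0
    ltn_add2l.
  by move: sF sG; rewrite /s; lia.
pose e0 : option K :=
  if eval G1 a == 0 then None else Some (eval F1 a / eval G1 a).
have val e : (eval (lform F1 G1 e) a == 0) = (e == e0).
  case: e => [c|]; rewrite /e0 /=; last by case: eqP.
  rewrite -mulNr -entire_constN evalD evalM evalC mulNr subr_eq0.
  have [G1a|G1a] := eqVneq (eval G1 a) 0.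
    by move: unit; rewrite G1a eqxx orbF mulr0 => /negPf ->.
  rewrite [RHS](_ : _ = (c == eval F1 a / eval G1 a)); last first.
    by apply/eqP/eqP => [[]|->].
  apply/eqP/eqP => [->|->]; first by rewrite mulfK.
  by rewrite divfK.
exists s, (ord a (lform F1 G1 e0)), e0; split=> [|e].
  by rewrite ord_gt0 // val.
rewrite ordl; have [->|ee0] := eqVneq e e0; first by rewrite mul1n.
rewrite mul0n; congr (_ + _)%N; apply/eqP; rewrite -leqn0 leqNgt ord_gt0 //.
by rewrite val.
Qed.

Lemma ord_prod_lform a F G s k e (T : seq (option K)) :
    (forall e, lform F G e != 0) -> local_position a F G s k e ->
  ord a (\prod_(e' <- T) lform F G e') = (size T * s + count_mem e T * k)%N.
Proof.
move=> l0 [_ lP]; elim: T => [|e' T IH].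
  by rewrite big_nil -entire_const1 ord_const // oner_neq0.
rewrite big_cons ordM //; last first.
  by rewrite prodf_seq_neq0; apply/allP => x _; exact: l0.
by rewrite IH lP /=; lia.
Qed.

Lemma wronskian_neq0_lform F G e : wronskian F G != 0 -> lform F G e != 0.
Proof.
move=> W0; have [e' ee'] : exists e', e != e'.
  by case: e => [c|]; [exists None | exists (Some 0)].
apply: contraNneq W0 => l0; have [c c0 WE] := wronskian_lform ee'.
have := WE F G; rewrite l0 /wronskian mul0r subr0.
have -> : entire_deriv 0 = 0 :> E.
  by apply/entireP => n; rewrite ecoef_deriv !ecoef0 mulr0.
rewrite mul0r => W0; apply/eqP; apply: (mulfI (entire_const_neq0 c0)).
by rewrite mulr0 W0.
Qed.

(** The factor common to [F] and [G] contributes its square, and the value taken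
with multiplicity [k] contributes [k - 1]. *)
Lemma ord_wronskian_position a F G s k e : wronskian F G != 0 ->
  local_position a F G s k e -> (2 * s + k <= (ord a (wronskian F G)).+1)%N.
Proof.
move=> W0 [_ lP]; have [e' ee'] : exists e', e != e'.
  by case: e lP => [c|] _; [exists None | exists (Some 0)].
have [c c0 WE] := wronskian_lform ee'.
have l0 e1 : lform F G e1 != 0 by exact: wronskian_neq0_lform.
have := ord_wronskian a (l0 e) (l0 e'); rewrite WE ordM ?entire_const_neq0 //.
rewrite ord_const // add0n mulf_neq0 ?entire_const_neq0 // => /(_ isT).
rewrite !lP eqxx (eq_sym e') (negPf ee'); lia.
Qed.

(** For each [c], the determinant [F G' - F' G] equals
[(F - c G) G' - (F' - c G') G]; with [c] the common value of [F / G] and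
[F' / G'], both terms vanish to the required order. *)
Lemma ord_cross a F G F' G' s k e s' k' e' :
    (forall x, lform F G x != 0) -> (forall x, lform F' G' x != 0) ->
    local_position a F G s k e -> local_position a F' G' s' k' e' ->
    F * G' - F' * G != 0 ->
  (s + s' + (e == e') * minn k k' <= ord a (F * G' - F' * G)%R)%N.
Proof.
move=> l0 l0' [_ lP] [_ lP'] X0; apply/ord_geP => //.
have zl x n : (n <= s + (x == e) * k)%N -> zdvd a n (lform F G x).
  by move=> nx; apply: zdvdW (zdvd_ord a (l0 x)); rewrite lP.
have zl' x n : (n <= s' + (x == e') * k')%N -> zdvd a n (lform F' G' x).
  by move=> nx; apply: zdvdW (zdvd_ord a (l0' x)); rewrite lP'.
pose c := if e is Some c then c else 0.
have id (T : comNzRingType) (f g f' g' x : T) :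
  f * g' - f' * g = (f - x * g) * g' - (f' - x * g') * g by ring.
rewrite (id _ F G F' G' (kc c)).
have zsplit x n m (A B : E) : (x <= n + m)%N -> zdvd a n A -> zdvd a m B ->
    zdvd a x (A * B).
  by move=> xnm zA zB; apply: zdvdW xnm (zdvdM zA zB).
apply: zdvdB.
  apply: (zsplit _ (s + (Some c == e) * k) (s' + (None == e') * k'))%N.
  - by rewrite /c; case: eqVneq => [<-|_]; [case: (e) => [x|] /=;
    rewrite ?eqxx|]; lia.
  - exact: (zl (Some c)).
  - exact: (zl' None).
apply: (zsplit _ (s' + (Some c == e') * k') (s + (None == e) * k))%N.
- by rewrite /c; case: eqVneq => [<-|_]; [case: (e) => [x|] /=;
  rewrite ?eqxx|]; lia.
- exact: (zl' (Some c)).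
- exact: (zl None).
Qed.

End LocalOrders.

(** * Two functions with the same fibres *)

(** In the application [ls d] is the fibre of [P] through [d], with each point
repeated according to its multiplicity, and [S] consists of critical points. *)
Definition dominates_fibre (T : eqType) (ls : T -> seq T) (S : seq T) (d : T) :=
  [/\ d \in S, forall c, c != d -> (count_mem c (ls d) < count_mem d (ls d))%N
    & forall d', d' \in S -> d' != d -> d' \notin ls d].

Section SharedFibres.
Variables (R : realType) (K : nonArchClosedFieldType R).
Local Notation E := (entire K).
Implicit Types (a c d : K) (e : option K) (S : seq K).

(** The equation [prod_c (f - c) = prod_c (g - c)], for [f = F / G] and
[g = F' / G'], with the denominators cleared. *)
Definition same_fibre (F G F' G' : E) (l : seq K) :=
  (\prod_(c <- l) lform F G (Some c)) * G' ^+ size l =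
  (\prod_(c <- l) lform F' G' (Some c)) * G ^+ size l.

Variables (F G F' G' : E) (S : seq K) (ls : K -> seq K).
Let T : seq (option K) := None :: map Some S.

(** The quotient [num / den] is [f' g' (f - g)^2 / prod_d (f - d) (g - d)] for
three points [d], written homogeneously: with [size S = 3], both are of degree 4
in [(F, G)] and in [(F', G')]. *)
Definition num := wronskian F G * wronskian F' G' * (F * G' - F' * G) ^+ 2.

Definition den := (\prod_(e <- T) lform F G e) * (\prod_(e <- T) lform F' G' e).

(** The orders [s] and [s'] of the common factors cancel by homogeneity. *)
Lemma same_fibre_count a s k e s' k' e' l :
    (forall e, lform F G e != 0) -> (forall e, lform F' G' e != 0) ->
    local_position a F G s k e -> local_position a F' G' s' k' e' ->
    same_fibre F G F' G' l ->
  (count_mem e (map Some l) * k + size l * (None == e') * k' =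
   count_mem e' (map Some l) * k' + size l * (None == e) * k)%N.
Proof.
move=> l0 l0' lP lP' /(congr1 (ord a)).
have prod0 (H L : E) : (forall e, lform H L e != 0) ->
    \prod_(c <- l) lform H L (Some c) != 0.
  by move=> h0; rewrite prodf_seq_neq0; apply/allP => x _; exact: h0.
have G0 : G != 0 := l0 None; have G'0 : G' != 0 := l0' None.
rewrite !ordM ?expf_neq0 ?prod0 // !ordX //.
have oG : ord a G = (s + (None == e) * k)%N by case: lP => _ /(_ None).
have oG' : ord a G' = (s' + (None == e') * k')%N by case: lP' => _ /(_ None).
have := ord_prod_lform (map Some l) l0 lP.
have := ord_prod_lform (map Some l) l0' lP'.
rewrite !big_map size_map oG oG' => -> ->.
by rewrite !mulnDr !mulnA; lia.
Qed.

(** Here [f] takes the value [e] with multiplicity [k], and [g] takes [e'] with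
multiplicity [k']. If [e = e'] is in [T], the fibre relation gives [k = k']. If
[e] is a point of [S] and [e'] another point of its fibre, then [e'] has a
smaller multiplicity in the fibre and so [k < k']; this strict inequality of
integers is what makes up for the pole. Two different points of [T] cannot
correspond. *)
Lemma position_inequality k e k' e' : uniq S -> size S = 3 ->
    (forall d, d \in S -> dominates_fibre ls S d) ->
    (0 < k)%N -> (0 < k')%N ->
    (forall d, d \in S ->
     count_mem e (map Some (ls d)) * k + size (ls d) * (None == e') * k' =
     count_mem e' (map Some (ls d)) * k' + size (ls d) * (None == e) * k)%N ->
  (count_mem e T * k + count_mem e' T * k' + 2 <=
   k + k' + 2 * ((e == e') * minn k k'))%N.
Proof.
move=> uS sS dom k0 k0' rel.
have uT : uniq T.
  rewrite /T /= map_inj_uniq ?uS ?andbT; last by move=> x y [].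
  by apply/mapP => -[].
rewrite !count_uniq_mem //.
have cSome c d : count_mem (Some c) (map Some (ls d)) = count_mem c (ls d).
  by rewrite count_map; apply: eq_count => x /=; apply/eqP/eqP => [[]|->].
have cNone d : count_mem None (map Some (ls d)) = 0%N.
  by rewrite count_map; apply/eqP; rewrite -leqn0 leqNgt -has_count;
    apply/hasPn.
have inT c : (Some c \in T) = (c \in S).
  by rewrite /T inE /=; apply/mapP/idP => [[x xS [->]]|cS] //; exists c.
have NT : None \in T by rewrite /T inE eqxx.
have szpos d : d \in S -> (0 < count_mem d (ls d) <= size (ls d))%N.
  move=> dS; rewrite count_size andbT.
  have [_ lt _] := dom d dS.
  have [d' dd'] : exists d', d' != d.
    by exists (d + 1); rewrite -subr_eq0 addrAC subrr add0r oner_neq0.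
  exact: leq_ltn_trans (lt d' dd').
have [d0 d0S] : exists d, d \in S.
  by case: (S) sS => [|d S'] // _; exists d; rewrite mem_head.
have sz0 := szpos d0 d0S.
have c_notin d d' : d \in S -> d' \in S -> d' != d -> count_mem d' (ls d) = 0%N.
  by move=> dS d'S dd'; apply/count_memPn; have [_ _] := dom d dS; apply.
have [ee'|ee'] := eqVneq e e'.
  rewrite -{}ee' in rel *; case: e rel => [c|] rel; last first.
    by have := rel d0 d0S; rewrite !cNone eqxx NT; nia.
  rewrite inT; have [cS|] := boolP (c \in S); last by lia.
  have := rel c cS; rewrite !cSome /=; have := szpos c cS; nia.
have larger x y m n : (x < y)%N -> (0 < n)%N -> (x * m = y * n)%N -> (n < m)%N.
  move=> xy n0 xmyn; rewrite ltnNge; apply/negP => mn.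
  have : (x * m <= x * n)%N by rewrite leq_mul2l mn orbT.
  have : (x * n < y * n)%N by rewrite ltn_pmul2r.
  by lia.
case: e e' rel ee' => [c|] [c'|] rel //= ee'.
- have fibre d : d \in S ->
      (count_mem c (ls d) * k = count_mem c' (ls d) * k')%N.
    by move=> /rel; rewrite !cSome /= !muln0 !addn0.
  have cc' : c' != c by apply: contraNneq ee' => ->.
  rewrite !inT; have [cS|cS] := boolP (c \in S).
    have [_ /(_ c' cc') lt _] := dom c cS.
    have [c'S|c'S] := boolP (c' \in S); last first.
      by have := larger _ _ _ _ lt k0 (esym (fibre c cS)); lia.
    have := fibre c cS; rewrite (c_notin c c') // mul0n => /eqP.
    by rewrite muln_eq0; have := szpos c cS; lia.
  have [c'S|c'S] := boolP (c' \in S); last by lia.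
  have [_ lt _] := dom c' c'S; rewrite eq_sym in cc'.
  by have := larger _ _ _ _ (lt c cc') k0' (fibre c' c'S); lia.
- have := rel d0 d0S; rewrite cNone /= muln1 muln0 mul0n !addn0 => /eqP.
  by rewrite addn_eq0 !muln_eq0; lia.
- have := rel d0 d0S; rewrite cNone /= muln1 muln0 !mul0n addn0 => /esym/eqP.
  by rewrite addn_eq0 !muln_eq0; lia.
Qed.

Lemma ord_den_le_num a : uniq S -> size S = 3 ->
    (forall d, d \in S -> dominates_fibre ls S d) ->
    (forall d, d \in S -> same_fibre F G F' G' (ls d)) ->
  num != 0 -> (ord a den <= ord a num)%N.
Proof.
move=> uS sS dom same num0.
have W0 : wronskian F G != 0.
  by apply: contraNneq num0 => W0; rewrite /num W0 !mul0r.
have W0' : wronskian F' G' != 0.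
  by apply: contraNneq num0 => W0'; rewrite /num W0' mulr0 mul0r.
have X0 : F * G' - F' * G != 0.
  by apply: contraNneq num0 => X0; rewrite /num X0 expr0n mulr0.
have l0 e : lform F G e != 0 by exact: wronskian_neq0_lform.
have l0' e : lform F' G' e != 0 by exact: wronskian_neq0_lform.
have [s [k [e lP]]] := local_positionP a l0.
have [s' [k' [e' lP']]] := local_positionP a l0'.
have sT : size T = 4 by rewrite /T /= size_map sS.
have prod0 (H L : E) : (forall e, lform H L e != 0) ->
    \prod_(x <- T) lform H L x != 0.
  by move=> h0; rewrite prodf_seq_neq0; apply/allP => x _; exact: h0.
rewrite /den ordM ?prod0 // (ord_prod_lform T l0 lP) (ord_prod_lform T l0' lP').
rewrite /num ordM ?mulf_neq0 ?expf_neq0 // ordM // ordX // sT.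
have := ord_wronskian_position W0 lP; have := ord_wronskian_position W0' lP'.
have := ord_cross l0 l0' lP lP' X0.
have : (count_mem e T * k + count_mem e' T * k' + 2 <=
        k + k' + 2 * ((e == e') * minn k k'))%N.
  apply: position_inequality => // [||d dS]; [by case: lP|by case: lP'|].
  exact: (same_fibre_count l0 l0' lP lP' (same d dS)).
lia.
Qed.

(** The estimate for four values applies to both wronskians, and [F G' - F' G]
is at most the product of the norms of the two pairs. Of the two factors [r] so
obtained, one is enough to tend to zero. *)
Lemma gauss_num_le_den : uniq S -> size S = 3 ->
  exists C : R, forall r, 1 <= r -> r * gauss num r <= C * gauss den r.
Proof.
rewrite /den /T; case: (S) => [|d1 [|d2 [|d3 [|? ?]]]] //= + _.
rewrite !inE negb_or andbT => /andP[/andP[d12 d13] d23].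
have neqS (c d : K) : c != d -> Some c != Some d.
  by apply: contraNneq => -[->].
have [C C0 CP] := @gauss_wronskian_four R K None (Some d1) (Some d2) (Some d3)
  isT (neqS _ _ d23) isT isT (neqS _ _ d12) (neqS _ _ d13).
exists (C * C) => r r1; have r0 := lt_le_trans ltr01 r1.
have h := CP F G r r0; have h' := CP F' G' r r0.
have cross : gauss (F * G' - F' * G) r <=
    Num.max (gauss F r) (gauss G r) * Num.max (gauss F' r) (gauss G' r).
  rewrite (le_trans (gaussB _ _ r0)) // ge_max !(gaussM _ _ r0).
  apply/andP; split; last rewrite mulrC;
    by apply: ler_pM; rewrite ?gauss_ge0 // le_max lexx ?orbT.
rewrite !big_cons !big_nil !mulr1 /num !(gaussM _ _ r0).
move: h h' cross (gauss_ge0 (F * G' - F' * G) r0).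
move: (gauss_ge0 (wronskian F G) r0) (gauss_ge0 (wronskian F' G') r0).
set w := gauss (wronskian F G) r; set w' := gauss (wronskian F' G') r.
set s := Num.max (gauss F r) _; set s' := Num.max (gauss F' r) _.
set x := gauss (F * G' - F' * G) r => w0 w'0 h h' xs x0.
set D := _ * _ * (_ * _) in h; set D' := _ * _ * (_ * _) in h'.
have x2 : x * x <= (s * s') * (s * s') by exact: ler_pM.
apply: le_trans (_ : (r * w * s ^+ 2) * (r * w' * s' ^+ 2) <= _).
  apply: le_trans (_ : r * (w * w' * ((s * s') * (s * s'))) <= _).
    by rewrite ler_pM2l // ler_wpM2l // mulr_ge0.
  have -> : r * w * s ^+ 2 * (r * w' * s' ^+ 2) =
            r * (r * (w * w' * ((s * s') * (s * s')))) by ring.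
  rewrite ler_pM2l // ler_peMl // mulr_ge0 //; first exact: mulr_ge0.
  by rewrite (le_trans _ x2) // mulr_ge0.
apply: le_trans (_ : (C * D) * (C * D') <= _).
  apply: ler_pM => //; apply: mulr_ge0; rewrite ?sqr_ge0 //.
    by apply: mulr_ge0 => //; exact: ltW.
  by apply: mulr_ge0 => //; exact: ltW.
rewrite le_eqVlt; apply/orP; left; apply/eqP; rewrite /D /D'; ring.
Qed.

(** The quotient [num / den] has no pole and tends to zero at infinity. *)
Lemma num_eq0 : uniq S -> size S = 3 ->
    (forall e, lform F G e != 0) -> (forall e, lform F' G' e != 0) ->
    (forall d, d \in S -> dominates_fibre ls S d) ->
    (forall d, d \in S -> same_fibre F G F' G' (ls d)) ->
  num = 0.
Proof.
move=> uS sS l0 l0' dom same; have [C CP] := gauss_num_le_den uS sS.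
apply: (@entire_quotient_eq0 R K num den C) => // [|num0 a].
  apply: mulf_neq0; rewrite prodf_seq_neq0; apply/allP => e _.
    exact: l0.
  exact: l0'.
exact: ord_den_le_num.
Qed.

End SharedFibres.

(** * Functions of vanishing wronskian *)

Section ConstantQuotients.
Variables (R : realType) (K : nonArchClosedFieldType R).
Hypothesis char0 : [pchar K] =i pred0.
Local Notation E := (entire K).
Local Notation kc := (@entire_const R K).
Implicit Types (F G H : E).

Lemma natr_inj_char0 (L : idomainType) (m n : nat) : [pchar L] =i pred0 ->
  m%:R = n%:R :> L -> m = n.
Proof.
move=> /pcharf0P c0; wlog mn : m n / (m <= n)%N => [hw|].
  by case: (leqP m n) => [|/ltnW] nm // h; [apply: hw|apply/esym/hw].
move=> h; apply/eqP; rewrite eqn_leq mn /= -subn_eq0 -c0 natrB //.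
by rewrite h subrr.
Qed.

(** Multiplying the wronskian by [z] turns derivation into multiplication of the
[n]-th coefficient by [n]; the first coefficient that can be nonzero is then
[m - n] times the product of the first nonzero coefficients. *)
Lemma wronskian0_low_index F G m n : wronskian F G = 0 ->
    (forall i, (i < m)%N -> F i = 0) -> F m != 0 ->
    (forall i, (i < n)%N -> G i = 0) -> G n != 0 ->
  m = n.
Proof.
move=> W0 Flow Fm Glow Gn.
have theta H i : (zsub 0 * entire_deriv H) i = i%:R * H i.
  case: i => [|i]; first by rewrite zsubM0 !mul0r oppr0.
  by rewrite zsubMS mul0r subr0 ecoef_deriv.
have id (T : comNzRingType) (z f f' g g' : T) :
  z * f' * g - f * (z * g') = z * (f' * g - f * g') by ring.
have : (zsub 0 * entire_deriv F * G - F * (zsub 0 * entire_deriv G))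
    (m + n)%N = 0.
  by rewrite id [_ - _]W0 mulr0 ecoef0.
rewrite ecoefB !ecoefM -sumrB; under eq_bigr do rewrite !theta.
have mlt : (m < (m + n).+1)%N by rewrite ltnS leq_addr.
rewrite (bigD1 (Ordinal mlt)) //= big1 ?addr0 => [|i im].
  rewrite addKn mulrCA -mulrA -mulrBl => /eqP.
  rewrite mulf_eq0 mulf_eq0 (negPf Fm) (negPf Gn) !orbF.
  by rewrite subr_eq0 => /eqP/(natr_inj_char0 char0).
have [mi|mi] := leqP m i.
  rewrite Glow ?mulr0 ?subr0 //.
  have : nat_of_ord i != m by apply: contraNneq im => im; apply/eqP/val_inj.
  have := ltn_ord i; lia.
by rewrite Flow // !(mulr0, mul0r) subr0.
Qed.

Lemma low_index F : F != 0 ->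
  exists2 m, F m != 0 & forall i, (i < m)%N -> F i = 0.
Proof.
move=> /entire_neq0 ex; case: (ex_minnP ex) => m Fm mmin; exists m => // i im.
by apply/eqP; apply: contraTT im => /mmin; rewrite -leqNgt.
Qed.

(** Subtracting from [F] the multiple of [G] with the same first nonzero
coefficient would give a function of vanishing wronskian with a first index
different from that of [G], unless it is zero. *)
Lemma wronskian_eq0 F G : G != 0 -> wronskian F G = 0 ->
  exists c, F = kc c * G.
Proof.
move=> G0 W0; have [->|F0] := eqVneq F 0.
  by exists 0; rewrite entire_const0 mul0r.
have [n Gn Glow] := low_index G0; have [m Fm Flow] := low_index F0.
have mn := wronskian0_low_index W0 Flow Fm Glow Gn; subst m.
exists (F n / G n); apply/eqP; rewrite -subr_eq0; apply: contraT => H0.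
have [m Hm Hlow] := low_index H0.
have HW : wronskian (F - kc (F n / G n) * G) G = 0.
  have [|c c0 WE] := @wronskian_lform R K (Some (F n / G n)) None; first by [].
  by have /= := WE F G => ->; rewrite W0 mulr0.
have mn := wronskian0_low_index HW Hlow Hm Glow Gn.
by move: Hm; rewrite mn ecoefB ecoefCM divfK // subrr eqxx.
Qed.

End ConstantQuotients.

(** * Multiplicities in the fibres and columns of a polynomial *)

Section Fibres.
Variables (L : closedFieldType) (P : {poly L}).
Hypothesis char0 : [pchar L] =i pred0.
Implicit Types (c d : L).

Definition fibre d : seq L := sval (closed_field_poly_normal (P - P.[d]%:P)).

Lemma fibreE d : P - P.[d]%:P =
  lead_coef (P - P.[d]%:P) *: \prod_(c <- fibre d) ('X - c%:P).
Proof. exact: (svalP (closed_field_poly_normal _)). Qed.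

Lemma count_fibre d c : P - P.[d]%:P != 0 ->
  count_mem c (fibre d) = mup c (P - P.[d]%:P).
Proof.
move=> q0; rewrite {1}fibreE -mul_polyC mupMr; first by rewrite mu_prod_XsubC.
by rewrite rootC lead_coef_eq0.
Qed.

Lemma mup_deriv (q : {poly L}) c : q != 0 -> root q c ->
  q^`() != 0 /\ mup c q = (mup c q^`()).+1.
Proof.
move=> q0 qc; have [m [h + qE]] := multiplicity_XsubC q c.
rewrite q0 /= => hc; have h0 : h != 0 by apply: contraNneq hc => ->;
  rewrite root0.
have mupq : mup c q = m by rewrite qE mupMr // mup_XsubCX eqxx.
case: m => [|m] in qE mupq *.
  by move: qc; rewrite qE expr0 mulr1 (negPf hc).
rewrite mupq qE.
have -> : (h * ('X - c%:P) ^+ m.+1)^`() =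
    (h^`() * ('X - c%:P) + m.+1%:R *: h) * ('X - c%:P) ^+ m.
  rewrite derivM deriv_exp derivXsubC /= mulrDl -mulrA -exprS mul1r.
  by rewrite -scaler_nat -scalerAr -scalerAl.
set g := _ + _; have gc : ~~ root g c.
  rewrite /root hornerD hornerM hornerXsubC subrr mulr0 add0r hornerZ.
  rewrite mulf_eq0 negb_or [X in _ && X]hc andbT.
  by move/pcharf0P: char0 => ->.
split; last by rewrite mupMr ?mup_XsubCX ?eqxx.
rewrite mulf_neq0 ?expf_neq0 ?polyXsubC_eq0 //.
by apply: contraNneq gc => ->; rewrite root0.
Qed.

End Fibres.

Section Columns.
Local Open Scope fset_scope.
Variables (L : closedFieldType) (P : {poly L}).
Implicit Types (c d : L) (C : {fset L}).

(** The assumption excludes that [P'] has infinitely many zeros. *)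
Lemma mem_crit d0 : d0 \in crit P -> forall d, (d \in crit P) = root P^`() d.
Proof.
rewrite /crit => + d; have [fin _|nfin] := pselect (finite_set [set d | root
  P^`() d]%classic).
  by rewrite in_fset_set //; apply/idP/idP; rewrite inE.
by rewrite /fset_set; case: pselect.
Qed.

Lemma columnP C : C \in columns P -> exists2 d0, d0 \in crit P &
  forall d, (d \in C) = (d \in crit P) && (P.[d] == P.[d0]).
Proof.
move=> /imfsetP[d0 /= d0c ->]; exists d0 => // d.
by rewrite /column !inE.
Qed.

(** A multiplicity that the first selection rejects is at most some repeated
one, and each selected one exceeds all repeated ones; so the largest selected
multiplicity is the maximum of the column, taken once. *)
Lemma column_dominant C : col_B_H2 P C != fset0 ->
  exists2 d, d \in C &
    forall c, c \in C -> c != d -> (crit_mult P c < crit_mult P d)%N.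
Proof.
move=> /fset0Pn[d0]; rewrite !inE => /andP[d0C].
rewrite mem_filter => /andP[_ d0H1].
pose H1 := col_A_H1 P C.
have exH1 : exists q, q \in H1 by exists (crit_mult P d0).
have ubH1 q : q \in H1 -> (q <= \max_(p <- H1) p)%N.
  by move=> qH1; apply: (leq_bigmax_seq (F := id)).
case: (ex_maxnP exH1 ubH1) => q qH1 qmax.
move: (qH1); rewrite mem_filter => /andP[/allP qlt].
rewrite mem_filter => /andP[/eqP count_q /mapP[d dC qE]].
have dC' : d \in C := dC.
exists d => // c cC cd; rewrite -qE.
have c_mult : crit_mult P c \in col_mults P C by apply/mapP; exists c.
have lt_q p : p \in col_mults P C -> p \notin col_A P C -> (p < q)%N.
  by move=> pC pA; have := qlt p pC; rewrite pA.
have [cA|cA] := boolP (crit_mult P c \in col_A P C); last exact: lt_q.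
have [cH1|] := boolP (crit_mult P c \in H1).
  rewrite ltn_neqAle qmax // andbT; apply/eqP => cq.
  have : (size [:: c; d] <= count_mem q (col_mults P C))%N.
    rewrite count_map -size_filter; apply: uniq_leq_size.
      by rewrite /= inE cd.
    move=> x; rewrite !inE => /orP[] /eqP ->; rewrite mem_filter /=.
      by rewrite cq eqxx.
    by rewrite -qE eqxx.
  by rewrite count_q.
rewrite mem_filter cA andbT => /allPn[p pC]; rewrite negb_imply -leqNgt.
by move=> /andP[pA cp]; apply: leq_ltn_trans cp (lt_q p pC pA).
Qed.

(** The multiplicity of a point in its fibre is one more than as a zero of [P'],
and it is one for the points of the fibre that are not critical. *)
Lemma t_num_points : [pchar L] =i pred0 -> (3 <= t_num P)%N ->
  exists S : seq L, [/\ uniq S, size S = 3 &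
    forall d, d \in S ->
      P - P.[d]%:P != 0 /\ dominates_fibre (fibre P) S d].
Proof.
move=> char0; rewrite /t_num; set X := [fset C in columns P | _].
move=> X3; have XP C : C \in X -> C \in columns P /\ col_B_H2 P C != fset0.
  by rewrite !inE => /andP.
have ex C : exists d, C \in X -> d \in C /\
    forall c, c \in C -> c != d -> (crit_mult P c < crit_mult P d)%N.
  have [CX|nCX] := boolP (C \in X); last by exists 0.
  have [d dC dmax] := column_dominant (XP C CX).2.
  by exists d.
have [D DP] := choice ex.
pose Cs := take 3 (enum_fset X).
have CsX C : C \in Cs -> C \in X by move=> /mem_take.
have Dval C C' : C \in X -> C' \in X -> P.[D C] = P.[D C'] -> C = C'.
  move=> CX C'X DD; have [DC _] := DP C CX; have [DC' _] := DP C' C'X.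
  have [d _ dP] := columnP (XP C CX).1;
    have [d' _ dP'] := columnP (XP C' C'X).1.
  apply/fsetP => x; rewrite dP dP'; congr (_ && (_ == _)).
  move: DC DC'; rewrite dP dP' => /andP[_ /eqP <-] /andP[_ /eqP <-].
  exact: DD.
exists (map D Cs); split.
- rewrite map_inj_in_uniq ?take_uniq ?fset_uniq //.
  by move=> C C' /CsX CX /CsX C'X DD; apply: Dval => //; rewrite DD.
- by rewrite size_map size_takel.
move=> _ /mapP[C CCs ->]; have CX := CsX C CCs.
have [DC Dmax] := DP C CX; have [d0 d0c colC] := columnP (XP C CX).1.
have CE x : (x \in C) = root P^`() x && (P.[x] == P.[D C]).
  move: DC; rewrite !colC (mem_crit d0c) => /andP[_ /eqP ->] //.
  by rewrite (mem_crit d0c).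
have [C' C'Cs C'C] : exists2 C', C' \in Cs & C' != C.
  apply: contrapT => nC'; have : (size Cs <= size [:: C])%N.
    apply: uniq_leq_size => [|C' C'Cs]; first by rewrite take_uniq ?fset_uniq.
    by rewrite inE; apply: contraT => C'C; case: nC'; exists C'.
  by rewrite size_takel.
set d := D C; pose q := P - P.[d]%:P.
have rootq x : root q x = (P.[x] == P.[d]).
  by rewrite /root /q hornerD hornerN hornerC subr_eq0.
have q0 : q != 0.
  apply: contraNneq C'C => q0; apply/eqP/Dval => //; first exact: CsX.
  by apply/eqP; rewrite -rootq q0 root0.
have qd : root q d by rewrite rootq.
have dq : q^`() = P^`() by rewrite /q derivB derivC subr0.
have [P'0 mupd] := mup_deriv char0 q0 qd; rewrite dq in P'0 mupd.
have P'd : root P^`() d by move: DC; rewrite CE => /andP[].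
split=> //; split=> [|c cd|_ /mapP[C1 C1Cs ->] dd].
- by apply/mapP; exists C.
- rewrite !count_fibre // mupd ltnS.
  have [qc|nqc] := boolP (root q c); last by rewrite mupNroot.
  have [_ ->] := mup_deriv char0 q0 qc; rewrite dq.
  have [P'c|nP'c] := boolP (root P^`() c); last first.
    by rewrite (mupNroot nP'c) -XsubC_dvd // dvdp_XsubCl.
  by apply: Dmax => //; rewrite CE P'c -rootq.
apply/negP => d1; case/eqP: dd; congr D; apply: Dval => //; first exact: CsX.
apply/eqP; rewrite -rootq /q fibreE rootZ ?lead_coef_eq0 //.
by rewrite root_prod_XsubC.
Qed.

End Columns.

(** * Meromorphic functions *)

Section FractionFields.

Lemma fraction_repr (D : idomainType) (f : {fraction D}) :
  exists a b : D, b != 0 /\ f * FracField.tofrac b = FracField.tofrac a.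
Proof.
elim/quotW: f => x; exists (frac x).1, (frac x).2; split;
  first exact: denom_ratioP.
unlock FracField.tofrac; rewrite -[LHS]FracField.pi_mul; apply/eqP.
rewrite FracField.equivf_def /= /FracField.mulf.
by rewrite !numden_Ratio ?mulf_neq0 ?oner_neq0 ?denom_ratioP // !mulr1 mulrC.
Qed.

End FractionFields.

Section Conclusion.
Variables (R : realType) (K : nonArchClosedFieldType R).
Local Notation E := (entire K).
Local Notation kc := (@entire_const R K).
Local Notation tofrac := (@FracField.tofrac E).

Let mero_const_zmod : zmod_morphism (@mero_const R K).
Proof.
by move=> x y; rewrite /mero_const entire_constD entire_constN rmorphB.
Qed.

Let mero_const_monoid : monoid_morphism (@mero_const R K).
Proof.
split=> [|x y]; first by rewrite /mero_const entire_const1 rmorph1.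
by rewrite /mero_const entire_constM rmorphM.
Qed.

HB.instance Definition _ := GRing.isZmodMorphism.Build K (meromorphic K)
  (@mero_const R K) mero_const_zmod.
HB.instance Definition _ := GRing.isMonoidMorphism.Build K (meromorphic K)
  (@mero_const R K) mero_const_monoid.


(** Over a fibre of [P], the equation [P(f) = P(g)] becomes an identity between
products of linear forms, where the denominators compensate each other. *)
Lemma same_fibre_of_eq (P : {poly K}) (f g : meromorphic K) (F G F' G' : E) d :
    G != 0 -> G' != 0 ->
    f * tofrac G = tofrac F -> g * tofrac G' = tofrac F' ->
    P - P.[d]%:P != 0 ->
    (map_poly (@mero_const R K) P).[f] = (map_poly (@mero_const R K) P).[g] ->
  same_fibre F G F' G' (fibre P d).
Proof.
move=> G0 G'0 fG gG q0 Pfg; set l := fibre P d.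
have value (h : meromorphic K) :
    (map_poly (@mero_const R K) (P - P.[d]%:P)).[h] =
    mero_const (lead_coef (P - P.[d]%:P)) * \prod_(c <- l) (h - mero_const c).
  rewrite {1}fibreE map_polyZ hornerZ rmorph_prod horner_prod.
  congr (_ * _); apply: eq_bigr => c _.
  by rewrite rmorphB /= map_polyX map_polyC /= hornerXsubC.
have prod_eq : \prod_(c <- l) (f - mero_const c) = \prod_(c <- l) (g -
  mero_const c).
  have lc0 : mero_const (lead_coef (P - P.[d]%:P)) != 0 :> meromorphic K.
    by rewrite fmorph_eq0 lead_coef_eq0.
  apply: (mulfI lc0); rewrite -!value rmorphB /= map_polyC.
  by rewrite !hornerD Pfg !hornerN !hornerC.
have clear (h : meromorphic K) (A B : E) (s : seq K) :
    h * tofrac B = tofrac A ->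
    tofrac (\prod_(c <- s) lform A B (Some c)) =
    (\prod_(c <- s) (h - mero_const c)) * tofrac B ^+ size s.
  move=> hB; elim: s => [|c s IH]; first by rewrite !big_nil tofrac1 mul1r.
  rewrite !big_cons tofracM IH exprS mulrACA; congr (_ * _).
  by rewrite tofracB tofracM -hB mulrBl.
apply/eqP; rewrite -tofrac_eq; apply/eqP; rewrite !tofracM !tofracXn.
by rewrite (clear f F G l fG) (clear g F' G' l gG) prod_eq mulrAC.
Qed.

Lemma mero_repr (f : meromorphic K) : exists F G : E,
  [/\ G != 0, f * tofrac G = tofrac F &
    [pchar K] =i pred0 -> mero_nonconstant f -> wronskian F G != 0].
Proof.
have [F [G [G0 fG]]] := fraction_repr f; exists F, G; split=> // char0 nonc.
apply/eqP => /(wronskian_eq0 char0 G0)[c Fc]; apply: (nonc c).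
have tG0 : tofrac G != 0 by rewrite tofrac_eq0.
by apply: (mulIf tG0); rewrite fG Fc /mero_const tofracM.
Qed.

End Conclusion.

Theorem theorem3p3 (R : realType) (K : nonArchClosedFieldType R)
    (char0 : [pchar K] =i pred0) (P : {poly K})
    (simple_zeros : forall z : K, root P z -> mup z P = 1%N)
    (ht : (3 <= t_num P)%N) (ht' : (3 <= t'_num P)%N) :
  UPM P.
Proof.
have [S [uS sS dom]] := t_num_points char0 ht.
have [d0 d0S] : exists d, d \in S.
  by case: (S) sS => [|d S'] // _; exists d; rewrite mem_head.
split=> [|f g f_nc g_nc Pfg].
  have [q0 _] := dom d0 d0S; rewrite ltnNge; apply: contra q0 => P1.
  by rewrite (size1_polyC P1) hornerC subrr.
have [F [G [G0 fG /(_ char0 f_nc) W0]]] := mero_repr f.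
have [F' [G' [G'0 gG' /(_ char0 g_nc) W0']]] := mero_repr g.
have num0 : num F G F' G' = 0.
  apply: (@num_eq0 R K F G F' G' S (fibre P)) => // [e|e|d dS|d dS].
  - exact: wronskian_neq0_lform.
  - exact: wronskian_neq0_lform.
  - by have [] := dom d dS.
  - by have [q0 _] := dom d dS; exact: same_fibre_of_eq Pfg.
have X0 : F * G' - F' * G = 0.
  apply/eqP; apply: contraT => X0.
  have : num F G F' G' != 0 by rewrite /num !mulf_neq0 ?expf_neq0.
  by rewrite num0 eqxx.
have tG0 : FracField.tofrac G != 0 by rewrite tofrac_eq0.
have tG'0 : FracField.tofrac G' != 0 by rewrite tofrac_eq0.
apply: (mulIf tG0); apply: (mulIf tG'0).
rewrite fG mulrAC gG' -!tofracM; congr FracField.tofrac.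
by apply/eqP; rewrite -subr_eq0 X0.
Qed.
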